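(* Let $K_1,K_2$ be compact Choquet simplexes and let $F\subset K_1$ be a closed face. Let $f\in A(F,A(K_2))$ be non-negative, i.e. $f(k)\ge0$ in $A(K_2)$ for every $k\in F$. Then there is a non-negative $g\in A(K_1,A(K_2))$ with $g|_F=f$ and $\sup_{k\in K_1}\|g(k)\|=\sup_{k\in F}\|f(k)\|$.
   Context: $A(K_2)$ is the order unit space of real-valued affine continuous functions on $K_2$ with the supremum norm and pointwise order. For a compact convex set $L$, $A(L,A(K_2))$ is the space of affine maps $L\to A(K_2)$ continuous for the norm topology, with the supremum norm; non-negativity is pointwise in $A(K_2)$. *)

(* Defs.v *)
From HB Require Import structures.
From mathcomp Require Import all_boot all_order all_algebra.
From mathcomp Require Import all_classical all_reals all_analysis.
Set Implicit Arguments. Unset Strict Implicit. Unset Printing Implicit Defensive.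
Import Order.TTheory GRing.Theory Num.Theory.
Import numFieldNormedType.Exports.
Local Open Scope classical_set_scope.
Local Open Scope ring_scope.

Section Defs.
Variable R : realType.

Definition convex_set (E : lmodType R) (K : set E) : Prop :=
  forall x y (l : R), K x -> K y -> 0 <= l <= 1 -> K (l *: x + (1 - l) *: y).

Definition compact_convex (E : tvsType R) (K : set E) : Prop :=
  hausdorff_space E /\ compact K /\ convex_set K /\ K !=set0.

Definition is_face (E : lmodType R) (K F : set E) : Prop :=
  F `<=` K /\ convex_set F /\
  forall x y (l : R), K x -> K y -> 0 < l < 1 ->
    F (l *: x + (1 - l) *: y) -> F x /\ F y.

(* the order on E x R induced by the cone C = {(t x, t) | t >= 0, x in K}:
   p <=_C q iff q - p in C *)
Definition cone_le (E : lmodType R) (K : set E) (p q : E * R) : Prop :=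
  exists t : R, 0 <= t /\ exists x, K x /\ q.1 - p.1 = t *: x /\ q.2 - p.2 = t.

Definition cone (E : lmodType R) (K : set E) (p : E * R) : Prop :=
  cone_le K (0, 0) p.

Definition choquet_simplex (E : tvsType R) (K : set E) : Prop :=
  compact_convex K /\
  forall p q, cone K p -> cone K q ->
    (exists m, [/\ cone K m, cone_le K m p, cone_le K m q &
       forall m', cone K m' -> cone_le K m' p -> cone_le K m' q -> cone_le K m' m])
    /\
    (exists M, [/\ cone K M, cone_le K p M, cone_le K q M &
       forall M', cone K M' -> cone_le K p M' -> cone_le K q M' -> cone_le K M M']).

Definition affine_on (E : lmodType R) (V : lmodType R) (K : set E) (h : E -> V) : Prop :=
  forall x y (l : R), K x -> K y -> 0 <= l <= 1 ->
    h (l *: x + (1 - l) *: y) = l *: h x + (1 - l) *: h y.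

Definition in_A (E : tvsType R) (K : set E) (h : E -> R) : Prop :=
  affine_on K (h : E -> R^o) /\ {within K, continuous h}.

Definition supnorm (E : tvsType R) (K : set E) (h : E -> R) : R :=
  sup [set `|h x| | x in K].

(* membership in A(L, A(K2)): f : L -> A(K2) (functions represented on the
   ambient spaces), affine, continuous for the sup norm of A(K2) *)
Definition in_AA (E1 E2 : tvsType R) (L : set E1) (K2 : set E2)
    (f : E1 -> E2 -> R) : Prop :=
  [/\ forall k, L k -> in_A K2 (f k),
      forall k k' (l : R), L k -> L k' -> 0 <= l <= 1 -> forall x, K2 x ->
        f (l *: k + (1 - l) *: k') x = l * f k x + (1 - l) * f k' x &
      forall k, L k -> forall e : R, 0 < e -> exists U, nbhs k U /\
        forall k', L k' -> U k' -> supnorm K2 (fun x => f k' x - f k x) < e].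

Definition nonneg_AA (E1 E2 : tvsType R) (L : set E1) (K2 : set E2)
    (f : E1 -> E2 -> R) : Prop :=
  forall k, L k -> forall x, K2 x -> 0 <= f k x.

Definition supnorm_AA (E1 E2 : tvsType R) (L : set E1) (K2 : set E2)
    (f : E1 -> E2 -> R) : R :=
  sup [set supnorm K2 (f k) | k in L].

End Defs.

(* Main.v *)
(** The extension is a continuous affine
    selection (Lazar) of the convex-valued map sending k to {f k} if k is in F
    and to the order interval [0, M] of A(K2) otherwise, M being the norm of f.
    The face property makes the graph of this map convex, closedness of F makes
    the map lower semicontinuous.

    For real values, let G be a relatively open convex subset of K1 x R all of
    whose fibres are nonempty.  Hahn-Banach yields finitely many continuous
    affine a_i and b_j, with all a_i < b_j, such that over each point of K1
    some a_i and some b_j lie in G.  The Riesz decomposition property of the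
    cone over K1 makes the hulls of the graphs of the a_i and of the b_j
    disjoint, so a continuous affine h separates them, and its graph lies in G.
    Choosing one coordinate at a time extends this to values in a
    finite-dimensional space.  A lower semicontinuous convex-valued map is then
    approximated by compactness, and a selection is the uniform limit of
    such approximations, each chosen close to the previous one. *)
Require Import Defs.
From HB Require Import structures.
From mathcomp Require Import all_boot all_order all_algebra.
From mathcomp Require Import all_classical all_reals all_analysis.
From mathcomp Require Import ring lra.
Import Order.TTheory GRing.Theory Num.Theory.
Import numFieldNormedType.Exports.
Local Open Scope classical_set_scope.
Local Open Scope ring_scope.
Set Implicit Arguments.
Unset Strict Implicit.

(** * Hahn-Banach separation *)

Definition sublinear (R : realType) (E : lmodType R) (p : E -> R) : Prop :=
  (forall x y, p (x + y) <= p x + p y) /\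
  (forall t x, 0 < t -> p (t *: x) = t * p x).

Lemma sublinear0 (R : realType) (E : lmodType R) (p : E -> R) :
  sublinear p -> p 0 = 0.
Proof.
move=> [_ sp]; have := sp 2 0 ltac:(lra).
by rewrite scaler0; lra.
Qed.

Lemma sublinear_geN (R : realType) (E : lmodType R) (p : E -> R) (x : E) :
  sublinear p -> - p (- x) <= p x.
Proof.
move=> sp; have := sp.1 x (- x); rewrite subrr (sublinear0 sp); lra.
Qed.

(** Zorn's lemma for the reversed pointwise order. A chain below [p] has a finite pointwise infimum,
    since each member satisfies [q x >= - q (- x) >= - p (- x)]. *)
Lemma exists_minimal_sublinear (R : realType) (E : lmodType R) (p : E -> R) :
  sublinear p ->
  exists q, [/\ sublinear q, forall x, q x <= p x &
    forall q', sublinear q' -> (forall x, q' x <= q x) ->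
      forall x, q' x = q x].
Proof.
move=> sp.
pose T := {q : E -> R | sublinear q /\ forall x, q x <= p x}.
pose le (q q' : T) := `[< forall x, sval q' x <= sval q x >].
have lexx q : le q q by apply/asboolP => x.
have letr r s t : le r s -> le s t -> le r t.
  move=> /asboolP rs /asboolP st; apply/asboolP => x.
  exact: le_trans (st x) (rs x).
have leas s t : le s t -> le t s -> s = t.
  case: s t => [s ps] [t pt] /asboolP/= st /asboolP/= ts.
  have e : s = t by apply/funext => x; apply/eqP; rewrite eq_le st ts.
  by case: t / e pt {st ts} => pt; congr exist; exact: Prop_irrelevance.
have [A totA|[q [sq qp]] qmin] := Zorn lexx letr leas; last first.
  exists q; split=> // q' sq' q'q.
  have q'p x : q' x <= p x by apply: le_trans (q'q x) (qp x).
  have /(congr1 sval)/= q'E := qmin (exist _ q' (conj sq' q'p)) (asboolT q'q).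
  by rewrite q'E.
have [[q0 Aq0]|A0] := pselect (A !=set0); last first.
  have pp x : p x <= p x by [].
  exists (exist _ p (conj sp pp)).
  by move=> s As; case: A0; exists s.
pose V x := [set sval q x | q in A].
have Vinf x : has_inf (V x).
  split; first by exists (sval q0 x), q0.
  exists (- p (- x)) => _ [q Aq <-].
  apply: le_trans (sublinear_geN x (svalP q).1).
  by rewrite lerN2 (svalP q).2.
have Vle q x : A q -> inf (V x) <= sval q x.
  by move=> Aq; apply: ge_inf; [exact: (Vinf x).2|exists q].
have sV : sublinear (fun x => inf (V x)).
  split=> [x y|t x t0].
    rewrite -lerBlDr. apply: lb_le_inf; first exact: (Vinf x).1.
    move=> _ [q1 Aq1 <-]; rewrite lerBlDr -lerBlDl.
    apply: lb_le_inf; first exact: (Vinf y).1.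
    move=> _ [q2 Aq2 <-]; rewrite lerBlDl.
    (* The infima at [x] and [y] may be approached by different members of the chain; the smaller of
       the two serves at both points. *)
    have [/asboolP q12|/asboolP q21] := totA _ _ Aq1 Aq2.
      apply: (le_trans (Vle _ _ Aq2)).
      by apply: le_trans ((svalP q2).1.1 x y) _; rewrite lerD2r.
    apply: (le_trans (Vle _ _ Aq1)).
    by apply: le_trans ((svalP q1).1.1 x y) _; rewrite lerD2l.
  apply/eqP; rewrite eq_le; apply/andP; split.
    rewrite mulrC -ler_pdivrMr//; apply: lb_le_inf; first exact: (Vinf x).1.
    move=> _ [q Aq <-]; rewrite ler_pdivrMr// mulrC -(svalP q).1.2//.
    exact: Vle.
  apply: lb_le_inf; first exact: (Vinf _).1.
  move=> _ [q Aq <-]; rewrite (svalP q).1.2// ler_pM2l//; exact: Vle.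
have Vp x : inf (V x) <= p x by apply: le_trans (Vle _ _ Aq0) ((svalP q0).2 x).
exists (exist _ (fun x => inf (V x)) (conj sV Vp)) => q Aq.
by apply/asboolP => x /=; exact: Vle.
Qed.

(* The infimum over t of q (x + t y) - t q y is sublinear and below q. *)
Lemma sublinear_slide (R : realType) (E : lmodType R) (q : E -> R) (y : E) :
  sublinear q ->
  exists q', [/\ sublinear q', forall x, q' x <= q x & q' (- y) <= - q y].
Proof.
move=> sq.
pose V x := [set q (x + t *: y) - t * q y | t in [set t | 0 <= t]].
have q0 : q 0 = 0 := sublinear0 sq.
have qt t x : 0 <= t -> q (t *: x) = t * q x.
  by rewrite le_eqVlt => /predU1P[<-|/sq.2//]; rewrite scale0r mul0r.
have Vinf x : has_inf (V x).
  split; first by exists (q (x + 0 *: y) - 0 * q y), 0 => /=.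
  exists (- q (- x)) => _ [t /= t0 <-].
  have := sq.1 (x + t *: y) (- x).
  rewrite addrAC subrr add0r qt//; lra.
have Vle t x : 0 <= t -> inf (V x) <= q (x + t *: y) - t * q y.
  by move=> t0; apply: ge_inf; [exact: (Vinf x).2|exists t].
exists (fun x => inf (V x)); split; last 2 first.
- by move=> x; have := Vle 0 x (lexx _); rewrite scale0r addr0 mul0r subr0.
- by have := Vle 1 (- y) ltac:(lra); rewrite scale1r addNr q0 mul1r sub0r.
split=> [x z|t x t0].
  rewrite -lerBlDr. apply: lb_le_inf; first exact: (Vinf x).1.
  move=> _ [t /= t0 <-]; rewrite lerBlDr -lerBlDl.
  apply: lb_le_inf; first exact: (Vinf z).1.
  move=> _ [s /= s0 <-]; rewrite lerBlDl.
  apply: (le_trans (Vle (t + s) _ _)); first by rewrite addr_ge0.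
  have := sq.1 (x + t *: y) (z + s *: y).
  rewrite addrACA -scalerDl; lra.
apply/eqP; rewrite eq_le; apply/andP; split.
  rewrite mulrC -ler_pdivrMr//; apply: lb_le_inf; first exact: (Vinf x).1.
  move=> _ [s /= s0 <-]; rewrite ler_pdivrMr//.
  apply: (le_trans (Vle (t * s) _ _)); first by rewrite mulr_ge0// ltW.
  by rewrite -scalerA -scalerDr sq.2//; lra.
apply: lb_le_inf; first exact: (Vinf _).1.
move=> _ [s /= s0 <-].
(* The parameter [s] for [t *: x] corresponds to [t^-1 * s] for [x]. *)
apply: (@le_trans _ _ (t * (q (x + (t^-1 * s) *: y) - t^-1 * s * q y))).
  by rewrite ler_pM2l//; apply: Vle; rewrite mulr_ge0// invr_ge0 ltW.
have tn0 : t != 0 by rewrite gt_eqF.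
by rewrite mulrBr -(sq.2 t (x + _))// scalerDr scalerA !mulrA divff// mul1r.
Qed.

(** Sliding [p] along [w] first gives [p' (- w) <= - p w], which forces equality at [w] for anything
    odd below [p']. A minimal sublinear function below [p'] is odd, hence linear. *)
Lemma hahn_banach_sublinear (R : realType) (E : lmodType R) (p : E -> R) (w : E) :
  sublinear p ->
  exists phi : E -> R, [/\ forall x y, phi (x + y) = phi x + phi y,
    forall t x, phi (t *: x) = t * phi x,
    forall x, phi x <= p x & phi w = p w].
Proof.
move=> sp.
have [p' [sp' p'p p'w]] := sublinear_slide w sp.
have [q [sq qp' qmin]] := exists_minimal_sublinear sp'.
(* By minimality, sliding [q] along [y] changes nothing, so [q] itself satisfies the inequality
   gained by the slide. *)
have qN y : q (- y) = - q y.
  have [q' [sq' q'q q'y]] := sublinear_slide y sq.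
  apply/eqP; rewrite eq_le -(qmin q' sq' q'q) q'y/= (qmin q' sq' q'q).
  by have := sublinear_geN (- y) sq; rewrite opprK.
exists q; split.
- move=> x y; apply/eqP; rewrite eq_le sq.1/=.
  by have := sq.1 (x + y) (- y); rewrite addrK qN; lra.
- move=> t x; have [t0|t0|->] := ltgtP t 0.
  + by rewrite -[t]opprK scaleNr qN sq.2 ?oppr_gt0//; lra.
  + exact: sq.2.
  + by rewrite scale0r mul0r (sublinear0 sq).
- by move=> x; apply: le_trans (qp' x) (p'p x).
- apply/eqP; rewrite eq_le (le_trans (qp' w) (p'p w))/=.
  by have := le_trans (qp' (- w)) p'w; rewrite qN; lra.
Qed.

(** * Minkowski functionals of convex absorbing sets *)

Definition gauge (R : realType) (E : lmodType R) (S : set E) (x : E) : R :=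
  inf [set r | 0 < r /\ S (r^-1 *: x)].

Section gauge.
Variables (R : realType) (E : lmodType R) (S : set E).
Hypothesis cS : Defs.convex_set S.
Hypothesis S0 : S 0.
Hypothesis absS : forall x, exists2 r : R, 0 < r & S (r *: x).

Let lev x := [set r | 0 < r /\ S (r^-1 *: x)].

Let lev_inf x : has_inf (lev x).
Proof.
split; last by exists 0 => r [/ltW].
have [r r0 Sr] := absS x; exists r^-1; split; first by rewrite invr_gt0.
by rewrite invrK.
Qed.

Let gauge_ge x r : 0 < r -> S (r^-1 *: x) -> gauge S x <= r.
Proof. by move=> r0 Sr; apply: ge_inf; [exact: (lev_inf x).2|split]. Qed.

Lemma gauge_le1 x : S x -> gauge S x <= 1.
Proof. by move=> Sx; apply: gauge_ge; rewrite ?invr1 ?scale1r. Qed.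

Lemma gauge_ge1 x : ~ S x -> 1 <= gauge S x.
Proof.
move=> nSx; apply: lb_le_inf; first exact: (lev_inf x).1.
move=> r [r0 Sr]; rewrite leNgt; apply/negP => r1; apply: nSx.
have := @cS (r^-1 *: x) 0 r Sr S0 ltac:(lra).
by rewrite scaler0 addr0 scalerA divff ?gt_eqF// scale1r.
Qed.

Lemma gauge_sublinear : sublinear (gauge S).
Proof.
split=> [x y|t x t0].
  rewrite -lerBlDr; apply: lb_le_inf; first exact: (lev_inf x).1.
  move=> r [r0 Sr]; rewrite lerBlDr -lerBlDl.
  apply: lb_le_inf; first exact: (lev_inf y).1.
  move=> s [s0 Ss]; rewrite lerBlDl; apply: gauge_ge; first lra.
  have rs0 : 0 < r + s by lra.
  (* With weight [r / (r + s)], the points [x / r] and [y / s] combine to [(x + y) / (r + s)]. *)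
  have rs1 : 0 <= r / (r + s) <= 1.
    apply/andP; split; first by rewrite divr_ge0// ltW.
    by rewrite ler_pdivrMr//; lra.
  have := cS Sr Ss rs1; rewrite !scalerA scalerDr.
  have -> : r / (r + s) / r = (r + s)^-1 by field; apply/andP; split; lra.
  suff -> : (1 - r / (r + s)) / s = (r + s)^-1 by [].
  by field; apply/andP; split; lra.
have tn0 : t != 0 by rewrite gt_eqF.
apply/eqP; rewrite eq_le; apply/andP; split.
  rewrite mulrC -ler_pdivrMr//; apply: lb_le_inf; first exact: (lev_inf x).1.
  move=> r [r0 Sr]; rewrite ler_pdivrMr//; apply: gauge_ge.
    exact: mulr_gt0.
  by rewrite scalerA invfM -mulrA mulVf// mulr1.
apply: lb_le_inf; first exact: (lev_inf _).1.
move=> r [r0 Sr]; rewrite mulrC -ler_pdivlMr//; apply: gauge_ge.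
  exact: divr_gt0.
by rewrite invf_div mulrC -scalerA.
Qed.

End gauge.

(** * Separation of compact convex sets by continuous functionals *)

Section locally_convex.
Variables (R : realType) (E : tvsType R).

Lemma nbhs_convex (x : E) (U : set E) : nbhs x U ->
  exists V, [/\ nbhs x V, V `<=` U & Defs.convex_set V].
Proof.
move=> Ux; have [B cB [oB bB]] := @locally_convex R E.
have [V [BV Vx] VU] := bB x U Ux.
exists V; split=> //; first by apply: open_nbhs_nbhs; split=> //; exact: oB.
move=> y z l Vy Vz /andP[l0 l1].
have lp : Itv.spec (@Itv.num_sem R) (Itv.Real `[0%Z, 1%Z]) l.
  by rewrite /Itv.num_sem/= in_itv/= ger0_real//= l0 l1.
have := cB V (mem_set BV) y z (Itv.mk lp) (mem_set Vy) (mem_set Vz).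
by rewrite inE.
Qed.

Lemma nbhs0_absorbing (V : set E) (x : E) : nbhs 0 V ->
  exists2 r : R, 0 < r & V (r *: x).
Proof.
move=> V0.
have c : (fun r : R^o => r *: x) @ (0 : R^o) --> (0 : E).
  rewrite -(scale0r x).
  apply: (@continuous_comp _ _ _ (fun r : R^o => (r, x))
    (fun z : R^o * E => z.1 *: z.2)); last exact: scale_continuous.
  by apply: (@cvg_pair _ _ _ _ (nbhs (0 : R^o))); [exact: cvg_id|exact: cvg_cst].
have /nbhs_ballP[e /= e0 eV] := c V V0.
exists (e / 2); first by rewrite divr_gt0.
by apply: eV; rewrite /ball/= sub0r normrN gtr0_norm; lra.
Qed.

(** A bound by 1 on [V] scales to a bound by [e / 2] on the neighbourhood [(e / 2) V] of 0. *)
Lemma linear_bounded_continuous (phi : E -> R) (V : set E) :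
  (forall x y, phi (x + y) = phi x + phi y) ->
  (forall t x, phi (t *: x) = t * phi x) ->
  nbhs 0 V -> (forall x, V x -> `|phi x| <= 1) -> continuous phi.
Proof.
move=> phiD phiZ V0 Vphi x; apply/cvgrPdist_lt => e e0.
have e2 : e / 2 != 0 by rewrite gt_eqF//; lra.
have := nbhsT x (nbhs0Z e2 V0); apply: filterS => _ [_ [v Vv <-] <-].
rewrite phiD phiZ opprD addrA subrr add0r normrN normrM gtr0_norm; last lra.
apply: (@le_lt_trans _ _ (e / 2 * 1)); last lra.
by rewrite ler_pM2l ?Vphi//; lra.
Qed.

(** The set [c0 - C + V] is convex and absorbing and misses [c0], so its gauge is at least 1 there.
    A linear functional dominated by the gauge and equal to it at [c0] is at most 1 on the whole
    set. *)
Lemma separate0_compact (C : set E) : hausdorff_space E ->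
  compact C -> Defs.convex_set C -> C !=set0 -> ~ C 0 ->
  exists phi : E -> R, [/\ forall x y, phi (x + y) = phi x + phi y,
    forall t x, phi (t *: x) = t * phi x,
    continuous phi & forall c, C c -> 0 < phi c].
Proof.
move=> hE kC cC [c0 Cc0] C0.
have nC : nbhs (0 : E) (~` C).
  apply: open_nbhs_nbhs; split=> //; apply: closed_openC.
  exact: compact_closed.
have [U [U0 UC cU]] := nbhs_convex nC.
(* Symmetry of [V] turns the one-sided bound on [phi] into a bound on its absolute value, hence into
   continuity. *)
pose V := [set x | U x /\ U (- x)].
have V0 : nbhs 0 V.
  apply: filterI => //; have := nbhs0N U0; apply: filterS => _ [x Ux <-].
  by rewrite /= opprK.
have V00 : V 0 := nbhs_singleton V0.
pose S := [set c0 - c.1 + c.2 | c in C `*` V].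
have VS x : V x -> S x by move=> Vx; exists (c0, x) => //=; rewrite subrr add0r.
have cV : Defs.convex_set V.
  move=> x y l [Ux Ux'] [Uy Uy'] l01; split; first exact: cU.
  by rewrite opprD -!scalerN; exact: cU.
have cS : Defs.convex_set S.
  move=> _ _ l [[c v] /= [Cc Vv] <-] [[d w] /= [Cd Vw] <-] l01.
  exists (l *: c + (1 - l) *: d, l *: v + (1 - l) *: w) => /=.
    by split; [exact: cC|exact: cV].
  have c0E : c0 = l *: c0 + (1 - l) *: c0.
    by rewrite -scalerDl addrC subrK scale1r.
  transitivity (l *: c0 + (1 - l) *: c0 - (l *: c + (1 - l) *: d)
    + (l *: v + (1 - l) *: w)); first by rewrite -c0E.
  rewrite opprD (addrACA (l *: c0)) (addrACA (l *: c0 - l *: c)).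
  by rewrite !scalerDr !scalerN.
have aS x : exists2 r : R, 0 < r & S (r *: x).
  by have [r r0 Vr] := nbhs0_absorbing x V0; exists r => //; exact: VS.
have nS : ~ S c0.
  move=> [[c v] /= [Cc [Uv _]] /eqP].
  rewrite -addrA -[X in _ == X]addr0 (inj_eq (addrI c0)) addrC subr_eq0.
  move=> /eqP vc.
  by apply: (UC v) => //; rewrite vc.
have sp := gauge_sublinear cS aS.
have [phi [phiD phiZ phip phic0]] := hahn_banach_sublinear c0 sp.
have phi1 : 1 <= phi c0 by rewrite phic0; exact: (gauge_ge1 cS (VS _ V00) aS nS).
have phiN x : phi (- x) = - phi x by rewrite -scaleN1r phiZ mulN1r.
have phiS x : S x -> phi x <= 1.
  move=> Sx; apply: le_trans (phip x) _; exact: gauge_le1.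
exists phi; split=> //.
  apply: (linear_bounded_continuous phiD phiZ V0) => x Vx.
  rewrite ler_norml phiS ?andbT; last exact: VS.
  rewrite lerNl -phiN phiS//; apply: VS; case: Vx => Ux Ux'.
  by split; rewrite ?opprK.
(* The small multiple [r *: c0] in [V] makes the inequality strict:
   [phi c >= phi c0 - 1 + r * phi c0 > 0]. *)
move=> c Cc; have [r r0 Vr] := nbhs0_absorbing c0 V0.
have : phi (c0 - c + r *: c0) <= 1 by apply: phiS; exists (c, r *: c0).
rewrite !phiD phiN phiZ => h.
have : 0 < r * phi c0 by rewrite mulr_gt0//; lra.
lra.
Qed.

End locally_convex.

Section compact_convex_sets.
Variables (R : realType) (E : tvsType R).

Lemma hausdorff_prod_real : hausdorff_space E ->
  hausdorff_space ((E * R^o)%type : tvsType R).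
Proof.
move=> hE [x s] [y t] cl; congr pair.
  apply: hE => A B Ax By.
  have [||[u v] [/= Au Bu]] := cl (A `*` setT) (B `*` setT).
  - by exists (A, setT) => //=; split=> //; exact: filterT.
  - by exists (B, setT) => //=; split=> //; exact: filterT.
  by exists u; split; [case: Au|case: Bu].
apply: (@Rhausdorff R) => A B As Bt.
have [||[u v] [/= Au Bu]] := cl (setT `*` A) (setT `*` B).
- by exists (setT, A) => //=; split=> //; exact: filterT.
- by exists (setT, B) => //=; split=> //; exact: filterT.
by exists v; split; [case: Au|case: Bu].
Qed.

(** The difference set [B - A] is compact, convex and misses 0. Compactness leaves a gap between the
    maximum over [A] and the minimum over [B]; [c] is its midpoint. *)
Lemma separate_compact (A B : set E) : hausdorff_space E ->
  compact A -> Defs.convex_set A -> A !=set0 ->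
  compact B -> Defs.convex_set B -> B !=set0 ->
  (forall x, A x -> B x -> False) ->
  exists (phi : E -> R) (c : R),
    [/\ forall x y, phi (x + y) = phi x + phi y,
    forall t x, phi (t *: x) = t * phi x,
    continuous phi, forall x, A x -> phi x < c & forall x, B x -> c < phi x].
Proof.
move=> hE kA cA A0 kB cB B0 AB.
pose C := [set p.1 - p.2 | p in B `*` A].
have kC : compact C.
  apply: continuous_compact; last exact: compact_setX.
  by apply: continuous_subspaceT => x; exact: sub_continuous.
have cC : Defs.convex_set C.
  move=> _ _ l [[b a] /= [Bb Aa] <-] [[b' a'] /= [Bb' Aa'] <-] l01.
  exists (l *: b + (1 - l) *: b', l *: a + (1 - l) *: a') => /=.
    by split; [exact: cB|exact: cA].
  by rewrite !scalerBr opprD addrACA.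
have C0 : C !=set0.
  by move: A0 B0 => [a Aa] [b Bb]; exists (b - a), (b, a).
have nC0 : ~ C 0.
  move=> [[b a] /= [Bb Aa] /eqP]; rewrite subr_eq0 => /eqP ba.
  by apply: (AB a) => //; rewrite -ba.
have [phi [phiD phiZ cphi phiC]] := separate0_compact hE kC cC C0 nC0.
have phiBA b a : B b -> A a -> phi a < phi b.
  move=> Bb Aa; have := phiC (b - a) ltac:(by exists (b, a)).
  by rewrite phiD -scaleN1r phiZ; lra.
have [a Aa amax] := compact_EVT_max A0 kA (continuous_subspaceT cphi).
have [b Bb bmin] := compact_EVT_min B0 kB (continuous_subspaceT cphi).
have := phiBA b a (set_mem Bb) (set_mem Aa) => ab.
exists phi, ((phi a + phi b) / 2); split=> // x /mem_set.
- by move=> /amax; lra.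
- by move=> /bmin; lra.
Qed.

End compact_convex_sets.

(** A point of [A] lying below a point of [B] on the same vertical line prevents the separating
    hyperplane from being vertical, so it is the graph of an affine function. *)
Lemma separate_above_below (R : realType) (E : tvsType R)
    (A B : set (E * R^o)) : hausdorff_space E ->
  compact A -> Defs.convex_set A -> compact B -> Defs.convex_set B ->
  (forall p, A p -> B p -> False) ->
  (exists x s t, [/\ A (x, s), B (x, t) & s < t]) ->
  exists h : E -> R, [/\ continuous h,
    forall x y l, h (l *: x + (1 - l) *: y) = l * h x + (1 - l) * h y,
    forall p, A p -> p.2 < h p.1 & forall p, B p -> h p.1 < p.2].
Proof.
move=> hE kA cA kB cB AB [x [s [t [As Bt st]]]].
have [||phi [c [phiD phiZ cphi phiA phiB]]] :=
  @separate_compact _ (E * R^o : tvsType R)%type A B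
  (hausdorff_prod_real hE) kA cA _ kB cB _ AB.
- by exists (x, s).
- by exists (x, t).
pose d := phi (0, 1).
have phiE y r : phi (y, r) = phi (y, 0) + r * d.
  rewrite -phiZ -phiD; congr phi; congr pair => /=.
    by rewrite scaler0 addr0.
  by rewrite add0r /GRing.scale/= mulr1.
have d0 : 0 < d.
  have := lt_trans (phiA _ As) (phiB _ Bt); rewrite (phiE x s) (phiE x t).
  by rewrite ltrD2l -subr_gt0 -mulrBl pmulr_rgt0// subr_gt0.
exists (fun y => (c - phi (y, 0)) / d); split.
- move=> y; apply: cvgM; last exact: cvg_cst.
  apply: cvgB; first exact: cvg_cst.
  apply: (@continuous_comp _ _ _ (fun y : E => (y, 0 : R^o)) phi).
    by apply: (@cvg_pair _ _ _ _ (nbhs y) (nbhs (0 : R^o)));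
      [exact: cvg_id|exact: cvg_cst].
  exact: cphi.
- move=> y z l.
  have -> : (l *: y + (1 - l) *: z, 0 : R^o)
     = l *: (y, 0 : R^o) + (1 - l) *: (z, 0 : R^o).
    by congr pair; rewrite /= !scaler0 addr0.
  by rewrite phiD !phiZ; field; exact: lt0r_neq0.
- by move=> [y r] /phiA/=; rewrite phiE ltr_pdivlMr//; lra.
- by move=> [y r] /phiB/=; rewrite phiE ltr_pdivrMr//; lra.
Qed.

(** * Convex hulls *)

Section convex_combinations.
Variables (R : realType) (E : lmodType R).

(** Convexity without normalised weights; the case [a + b = 0] is included because the weights of a
    Riesz decomposition may vanish. *)
Lemma convex_set_scale (A : set E) (a b : R) (x y : E) : Defs.convex_set A ->
  A x -> A y -> 0 <= a -> 0 <= b ->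
  exists2 z, A z & (a + b) *: z = a *: x + b *: y.
Proof.
move=> cA Ax Ay; rewrite le_eqVlt => /predU1P[<-|a0] b0.
  by exists y => //; rewrite scale0r !add0r.
have ab0 : 0 < a + b by lra.
have abn0 := lt0r_neq0 ab0.
exists ((a / (a + b)) *: x + (1 - a / (a + b)) *: y).
  apply: cA => //; rewrite divr_ge0 ?(ltW a0) ?(ltW ab0)//=.
  by rewrite ler_pdivrMr//; lra.
rewrite scalerDr !scalerA; congr (_ *: _ + _ *: _); by field.
Qed.

Lemma affine_on_scale (K : set E) (h : E -> R) (a b : R) (x y z : E) :
  affine_on K (h : E -> R^o) -> K x -> K y -> 0 <= a -> 0 <= b ->
  (a + b) *: z = a *: x + b *: y ->
  (a + b) * h z = a * h x + b * h y.
Proof.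
move=> ah Kx Ky a0 b0 e.
have [/eqP ab0|abn0] := eqVneq (a + b) 0.
  move: ab0; rewrite paddr_eq0// => /andP[/eqP-> /eqP->].
  by rewrite addr0 !mul0r addr0.
have ab0 : 0 < a + b by rewrite lt_neqAle eq_sym abn0 addr_ge0.
have -> : z = (a / (a + b)) *: x + (1 - a / (a + b)) *: y.
  have -> : 1 - a / (a + b) = (a + b)^-1 * b by field.
  rewrite mulrC -!scalerA -scalerDr -e scalerA mulVf// scale1r//.
rewrite ah//; last by rewrite divr_ge0 ?(ltW ab0)//= ler_pdivrMr//; lra.
by rewrite /GRing.scale/=; field.
Qed.

(** For nonempty convex [A] and [B] this is the convex hull of their union; no closure is taken, and
    compactness is inherited all the same. *)
Definition hull2 (A B : set E) : set E :=
  [set x | exists l a b, [/\ 0 <= l <= 1, A a, B b & x = l *: a + (1 - l) *: b]].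

Lemma hull2l (A B : set E) : B !=set0 -> A `<=` hull2 A B.
Proof.
move=> [b Bb] a Aa; exists 1, a, b; split=> //; first by rewrite ler01 lexx.
by rewrite subrr scale0r addr0 scale1r.
Qed.

Lemma hull2r (A B : set E) : A !=set0 -> B `<=` hull2 A B.
Proof.
move=> [a Aa] b Bb; exists 0, a, b; split=> //; first by rewrite ler01 lexx.
by rewrite subr0 scale0r add0r scale1r.
Qed.

Lemma hull2_convex (A B : set E) :
  Defs.convex_set A -> Defs.convex_set B -> Defs.convex_set (hull2 A B).
Proof.
move=> cA cB _ _ s [l [a [b [/andP[l0 l1] Aa Bb ->]]]]
  [m [a' [b' [/andP[m0 m1] Aa' Bb' ->]]]] /andP[s0 s1].
have s1' : 0 <= 1 - s by lra.
have [a'' Aa'' ea] := convex_set_scale cA Aa Aa'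
  (mulr_ge0 s0 l0) (mulr_ge0 s1' m0).
have [b'' Bb'' eb] := @convex_set_scale B (s * (1 - l)) ((1 - s) * (1 - m))
  _ _ cB Bb Bb' ltac:(nra) ltac:(nra).
exists (s * l + (1 - s) * m), a'', b''; split=> //.
  by apply/andP; split; nra.
have -> : 1 - (s * l + (1 - s) * m) = s * (1 - l) + (1 - s) * (1 - m) by ring.
by rewrite ea eb !scalerDr !scalerA addrACA.
Qed.

End convex_combinations.

Section finite_hulls.
Variables (R : realType) (E : tvsType R).

Lemma hull2_compact (A B : set E) :
  compact A -> compact B -> compact (hull2 A B).
Proof.
move=> kA kB.
pose f (p : R^o * (E * E)) := p.1 *: p.2.1 + (1 - p.1) *: p.2.2.
have -> : hull2 A B = [set f p | p in [set` `[0 : R, 1]] `*` (A `*` B)].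
  apply/seteqP; split=> [_ [l [a [b [l01 Aa Bb ->]]]]|].
    by exists (l, (a, b)) => //; split=> //=; rewrite in_itv.
  move=> _ [[l [a b]] [/= l01 [Aa Bb]] <-]; exists l, a, b; split=> //.
apply: continuous_compact; last first.
  by apply: compact_setX; [exact: segment_compact|exact: compact_setX].
apply: continuous_subspaceT => p.
apply: (@continuous_comp _ _ _ (fun p : R^o * (E * E) =>
  (p.1 *: p.2.1, (1 - p.1) *: p.2.2)) (fun q : E * E => q.1 + q.2));
  last exact: add_continuous.
apply: cvg_pair.
  apply: (@continuous_comp _ _ _ (fun p : R^o * (E * E) => (p.1, p.2.1))
    (fun z : R^o * E => z.1 *: z.2)); last exact: scale_continuous.
  apply: (@cvg_pair _ _ _ _ (nbhs p.1) (nbhs p.2.1)); first exact: cvg_fst.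
  by apply: continuous_comp; [exact: cvg_snd|exact: cvg_fst].
apply: (@continuous_comp _ _ _ (fun p : R^o * (E * E) => (1 - p.1 : R^o, p.2.2))
  (fun z : R^o * E => z.1 *: z.2)); last exact: scale_continuous.
apply: (@cvg_pair _ _ _ _ (nbhs (1 - p.1 : R^o)) (nbhs p.2.2)).
  by apply: (@cvgB _ R^o); [exact: cvg_cst|exact: cvg_fst].
by apply: continuous_comp; [exact: cvg_snd|exact: cvg_snd].
Qed.

(** Iterating [hull2] gives the convex hull of the union, known afterwards only through its
    minimality among convex sets. *)
Lemma exists_finite_hull (I : eqType) (s : seq I) (C : I -> set E) :
  s != [::] ->
  (forall i, i \in s -> [/\ compact (C i), Defs.convex_set (C i) & C i !=set0]) ->
  exists D, [/\ compact D, Defs.convex_set D, forall i, i \in s -> C i `<=` D &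
    forall W, Defs.convex_set W -> (forall i, i \in s -> C i `<=` W) -> D `<=` W].
Proof.
elim: s => // i [|j s] IH _ Cs.
  have [kC cC C0] := Cs i (mem_head _ _).
  exists (C i); split=> // [_ /[!inE]/eqP->//|W cW]; apply; exact: mem_head.
have [||D [kD cD sD mD]] := IH; first by [].
  by move=> k ks; apply: Cs; rewrite inE ks orbT.
have [kC cC C0] := Cs i (mem_head _ _).
have D0 : D !=set0.
  have [_ _ [x Cx]] := Cs j ltac:(by rewrite !inE eqxx orbT).
  by exists x; apply: sD Cx; exact: mem_head.
exists (hull2 (C i) D); split.
- exact: hull2_compact.
- exact: hull2_convex.
- move=> k; rewrite inE => /predU1P[->|/sD kD']; first exact: hull2l.
  by apply: subset_trans kD' _; exact: hull2r.
- move=> W cW sW _ [l [a [b [l01 Ca Db ->]]]]; apply: (cW) => //.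
    by apply: sW Ca; exact: mem_head.
  apply: (mD W cW _ b Db) => k ks.
  by apply: sW; rewrite inE ks orbT.
Qed.

End finite_hulls.

(** * Interpolation on a simplex *)

(** Near-covering compactness, applied to the filter of finite families of centres directed by
    inclusion. *)
Lemma compact_finite_subcover (T : topologicalType) (K : set T) (U : T -> set T) :
  compact K -> (forall x, K x -> nbhs x (U x)) ->
  exists s : seq T, (forall x, x \in s -> K x) /\
    forall y, K y -> exists2 x, x \in s & U x y.
Proof.
move=> /compact_near_coveringP kK KU.
pose D := [set s : seq T | forall x, x \in s -> K x].
pose F : set_system (seq T) :=
  filter_from D (fun s => [set s' | D s' /\ {subset s <= s'}]).
have FF : Filter F.
  apply: filter_from_filter; first by exists [::].
  move=> s t Ds Dt; exists (s ++ t).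
    by move=> x; rewrite mem_cat => /orP[/Ds|/Dt].
  move=> r [Dr str]; split; split=> // x xs; apply: str;
    by rewrite mem_cat xs ?orbT.
have [|s Ds sP] := kK _ F (fun s y => exists2 x, x \in s & U x y) FF.
  move=> x Kx; exists (U x, [set s | D s /\ x \in s]); first split=> /=.
  - exact: KU.
  - exists [:: x]; first by move=> y; rewrite inE => /eqP->.
    by move=> s [Ds xs]; split=> //; apply: xs; exact: mem_head.
  - by move=> [y s] /= [Uxy [Ds xs]]; exists x.
by exists s; split=> //; exact: (sP s (conj Ds (fun x xs => xs))).
Qed.

Lemma within_continuous_realP (R : realType) (T : topologicalType) (K : set T)
    (h : T -> R) :
  {within K, continuous h} <->
  forall x, K x -> forall e, 0 < e ->
    exists2 U, nbhs x U & forall y, K y -> U y -> `|h y - h x| < e.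
Proof.
split=> [/subspace_continuousP hc x Kx e e0|hc].
  have /cvgrPdist_lt/(_ e e0) := hc x Kx.
  move=> He; exists (fun y => K y -> `|h x - h y| < e); first exact: He.
  by move=> y Ky /(_ Ky); rewrite distrC.
apply/subspace_continuousP => x Kx; apply/cvgrPdist_lt => e e0.
have [U Ux UP] := hc x Kx e e0.
by apply: filterS Ux => y Uy Ky; rewrite distrC; exact: UP.
Qed.

Section affine_functions.
Variables (R : realType) (E : tvsType R) (K : set E).

Lemma in_A0 : in_A K (fun=> 0 : R).
Proof.
split; first by move=> x y l _ _ _; rewrite !scaler0 addr0.
by apply: continuous_subspaceT => x; exact: cvg_cst.
Qed.

Lemma in_A_scaleD (t : R) (a b : E -> R) : in_A K a -> in_A K b ->
  in_A K (fun x => t * a x + b x).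
Proof.
move=> [aa ca] [ab cb]; split.
  move=> x y l Kx Ky l01; rewrite aa// ab// /GRing.scale/=; ring.
move=> x; apply: cvgD; last exact: cb.
by apply: cvgM; [exact: cvg_cst|exact: ca].
Qed.

Lemma in_AN (a : E -> R) : in_A K a -> in_A K (fun x => - a x).
Proof.
move=> Aa; have := in_A_scaleD (-1) Aa in_A0.
by under eq_fun do rewrite mulN1r addr0.
Qed.

End affine_functions.

(** * The cone over a simplex and its Riesz decomposition property *)

Section cone.
Variables (R : realType) (E : lmodType R) (K : set E).
Hypothesis cK : Defs.convex_set K.

Lemma coneP (p : E * R) :
  cone K p <-> exists2 x, K x & 0 <= p.2 /\ p.1 = p.2 *: x.
Proof.
split=> [[t [t0 [x [Kx]]]]|[x Kx [p0 px]]].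
  by rewrite !subr0 => -[-> ->]; exists x.
by exists p.2; split=> //; exists x; rewrite !subr0.
Qed.

Lemma cone_leE (p q : E * R) : cone_le K p q = cone K (q - p).
Proof. by rewrite /cone /cone_le /= !subr0. Qed.

Lemma coneD (p q : E * R) : cone K p -> cone K q -> cone K (p + q).
Proof.
move=> /coneP[x Kx [p0 px]] /coneP[y Ky [q0 qy]].
have [z Kz e] := convex_set_scale cK Kx Ky p0 q0.
by apply/coneP; exists z => //=; rewrite addr_ge0// px qy e.
Qed.

End cone.

Section simplex.
Variables (R : realType) (E : tvsType R) (K : set E).
Hypothesis sK : choquet_simplex K.

(* With M the join of p and q1, the part of p below q1 is p + q1 - M. *)
Lemma cone_Riesz (p q1 q2 : E * R) :
  cone K p -> cone K q1 -> cone K q2 -> cone K (q1 + q2 - p) ->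
  exists r, [/\ cone K r, cone K (p - r), cone K (q1 - r) &
    cone K (q2 - (p - r))].
Proof.
move=> Cp Cq1 Cq2; have [[_ [_ [cK _]]] lat] := sK => pq.
have [_ [M [CM pM qM minM]]] := lat p q1 Cp Cq1.
have pM' := pM; have qM' := qM.
rewrite !cone_leE in pM' qM'.
have CD := coneD cK.
have h1 : cone_le K M (p + q1).
  apply: minM; rewrite ?cone_leE; first exact: CD.
    by rewrite addrC addKr.
  by rewrite addrK.
have h2 : cone_le K M (q1 + q2).
  apply: minM; rewrite ?cone_leE//; first exact: CD.
  by rewrite addrC addKr.
rewrite !cone_leE in h1 h2.
have pr : p - (p + q1 - M) = M - q1.
  by rewrite !opprD opprK !addrA subrr add0r addrC.
exists (p + q1 - M); split=> //.
- by rewrite pr.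
- by rewrite !opprD opprK !addrA (addrAC q1) subrr add0r addrC.
- by rewrite pr opprB addrA (addrC q2).
Qed.

(** Two representations of one point have a common 2 x 2 refinement: [cone_Riesz] splits
    [(l *: x1, l)] along the two [y] terms, and the last coordinates of the pieces are the
    weights. *)
Lemma simplex_Riesz (x1 x2 y1 y2 : E) (l m : R) :
  K x1 -> K x2 -> K y1 -> K y2 -> 0 <= l <= 1 -> 0 <= m <= 1 ->
  l *: x1 + (1 - l) *: x2 = m *: y1 + (1 - m) *: y2 ->
  exists w11 w12 w21 w22 z11 z12 z21 z22,
    [/\ [/\ K z11, K z12, K z21 & K z22],
        [/\ 0 <= w11, 0 <= w12, 0 <= w21 & 0 <= w22],
        [/\ w11 + w12 = l, w21 + w22 = 1 - l, w11 + w21 = m & w12 + w22 = 1 - m] &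
        [/\ l *: x1 = w11 *: z11 + w12 *: z12,
            (1 - l) *: x2 = w21 *: z21 + w22 *: z22,
            m *: y1 = w11 *: z11 + w21 *: z21 &
            (1 - m) *: y2 = w12 *: z12 + w22 *: z22]].
Proof.
move=> Kx1 Kx2 Ky1 Ky2 /andP[l0 l1] /andP[m0 m1] e.
have l1' : 0 <= 1 - l by lra.
have m1' : 0 <= 1 - m by lra.
have C t x : 0 <= t -> K x -> cone K (t *: x, t).
  by move=> t0 Kx; apply/coneP; exists x.
have [|r []] := cone_Riesz (C _ _ l0 Kx1) (C _ _ m0 Ky1) (C _ _ m1' Ky2).
  rewrite (_ : _ - _ = ((1 - l) *: x2, 1 - l)); first exact: C.
  congr pair => /=; last by ring.
  by rewrite -e addrC addKr.
move=> /coneP[z11 K11 [w11 e11]] /coneP[z12 K12 [/= w12 /= e12]].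
move=> /coneP[z21 K21 [/= w21 /= e21]] /coneP[z22 K22 [/= w22 /= e22]].
exists r.2, (l - r.2), (m - r.2), (1 - m - (l - r.2)), z11, z12, z21, z22.
split=> //; split; [ring|ring|ring|ring| | | |].
- by rewrite -e11 -e12 addrC subrK.
- rewrite -e21 -e22 opprB addrACA addKr -e.
  by rewrite addrC addKr.
- by rewrite -e11 -e21 addrC subrK.
- by rewrite -e12 -e22 [RHS]addrC subrK.
Qed.

(** A hyperplane between the hull of the graphs of [a1], [a2] and the hull of those of [b1], [b2] is
    the graph of [h]. *)
Lemma simplex_interpolation2 (a1 a2 b1 b2 : E -> R) :
  in_A K a1 -> in_A K a2 -> in_A K b1 -> in_A K b2 ->
  (forall x, K x -> [/\ a1 x < b1 x, a1 x < b2 x, a2 x < b1 x & a2 x < b2 x]) ->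
  exists2 h, in_A K h & forall x, K x ->
    [/\ a1 x < h x, a2 x < h x, h x < b1 x & h x < b2 x].
Proof.
move=> Aa1 Aa2 Ab1 Ab2 ab.
have [[hE [kK [cK [x0 Kx0]]]] _] := sK.
pose graph (a : E -> R) : set (E * R^o) := [set (x, a x : R^o) | x in K].
have kG a : in_A K a -> compact (graph a).
  move=> [_ /subspace_continuousP ca]; apply: continuous_compact kK.
  apply/subspace_continuousP => x Kx.
  apply: (@cvg_pair _ _ _ _ (nbhs x) (nbhs (a x : R^o))); last exact: ca.
  exact: cvg_within.
have cG a : in_A K a -> Defs.convex_set (graph a).
  move=> [aa _] _ _ l [x Kx <-] [y Ky <-] l01.
  by exists (l *: x + (1 - l) *: y); [exact: cK|rewrite aa].
have GG a : graph a !=set0 by exists (x0, a x0), x0.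
pose A := hull2 (graph a1) (graph a2); pose B := hull2 (graph b1) (graph b2).
(* At a common point the refinement gives a zero sum of the terms [w_ij * (b_j - a_i)(z_ij)]. All
   gaps are positive, so every weight vanishes, although the weights add up to 1. *)
have AB p : A p -> B p -> False.
  move=> [l [_ [_ [l01 [x1 Kx1 <-] [x2 Kx2 <-] ->]]]].
  move=> [m [_ [_ [m01 [y1 Ky1 <-] [y2 Ky2 <-] [e1 e2]]]]].
  have [w11 [w12 [w21 [w22 [z11 [z12 [z21 [z22]]]]]]]] :=
    simplex_Riesz Kx1 Kx2 Ky1 Ky2 l01 m01 e1.
  move=> [[K11 K12 K21 K22] [w11p w12p w21p w22p]].
  move=> [d1 d2 d3 d4] [f1 f2 f3 f4].
  move: e2; rewrite /GRing.scale/=.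
  have S := affine_on_scale.
  rewrite -{1}d1 -{1}d2 -{1}d3 -{1}d4.
  rewrite (S _ _ _ _ _ _ _ _ _ Aa1.1 K11 K12 w11p w12p); last by rewrite d1.
  rewrite (S _ _ _ _ _ _ _ _ _ Aa2.1 K21 K22 w21p w22p); last by rewrite d2.
  rewrite (S _ _ _ _ _ _ _ _ _ Ab1.1 K11 K21 w11p w21p); last by rewrite d3.
  rewrite (S _ _ _ _ _ _ _ _ _ Ab2.1 K12 K22 w12p w22p); last by rewrite d4.
  have [p11 _ _ _] := ab _ K11; have [_ p12 _ _] := ab _ K12.
  have [_ _ p21 _] := ab _ K21; have [_ _ _ p22] := ab _ K22.
  move=> e.
  have q11 : 0 <= w11 * (b1 z11 - a1 z11) by rewrite mulr_ge0// subr_ge0 ltW.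
  have q12 : 0 <= w12 * (b2 z12 - a1 z12) by rewrite mulr_ge0// subr_ge0 ltW.
  have q21 : 0 <= w21 * (b1 z21 - a2 z21) by rewrite mulr_ge0// subr_ge0 ltW.
  have q22 : 0 <= w22 * (b2 z22 - a2 z22) by rewrite mulr_ge0// subr_ge0 ltW.
  have zero (w c : R) : 0 < c -> w * c = 0 -> w = 0.
    by move=> c0 /eqP; rewrite mulf_eq0 (gt_eqF c0) orbF => /eqP.
  have : w11 = 0 by apply: (zero _ (b1 z11 - a1 z11)); lra.
  have : w12 = 0 by apply: (zero _ (b2 z12 - a1 z12)); lra.
  have : w21 = 0 by apply: (zero _ (b1 z21 - a2 z21)); lra.
  have : w22 = 0 by apply: (zero _ (b2 z22 - a2 z22)); lra.
  lra.
have kA : compact A by apply: hull2_compact; exact: kG.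
have kB : compact B by apply: hull2_compact; exact: kG.
have cA : Defs.convex_set A by apply: hull2_convex; exact: cG.
have cB : Defs.convex_set B by apply: hull2_convex; exact: cG.
have [|h [hc ha hA hB]] := separate_above_below hE kA cA kB cB AB.
  exists x0, (a1 x0), (b1 x0); split; last by have [] := ab _ Kx0.
    by apply: hull2l => //; exists x0.
  by apply: hull2l => //; exists x0.
exists h.
  split; first by move=> x y l _ _ _; exact: ha.
  exact: continuous_subspaceT.
move=> x Kx; split.
- by apply: (hA (x, a1 x)); apply: hull2l => //; exists x.
- by apply: (hA (x, a2 x)); apply: hull2r => //; exists x.
- by apply: (hB (x, b1 x)); apply: hull2l => //; exists x.
- by apply: (hB (x, b2 x)); apply: hull2r => //; exists x.
Qed.

(** Two inductions reduce to the 2 x 2 case: an interpolant for the tail of a list stands in for all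
    functions of that tail, first among the upper bounds ([two]), then among the lower ones. *)
Lemma simplex_interpolation (I J : eqType) (s : seq I) (t : seq J)
    (a : I -> E -> R) (b : J -> E -> R) : s != [::] -> t != [::] ->
  (forall i, i \in s -> in_A K (a i)) -> (forall j, j \in t -> in_A K (b j)) ->
  (forall i j x, i \in s -> j \in t -> K x -> a i x < b j x) ->
  exists2 h, in_A K h & forall x, K x ->
    (forall i, i \in s -> a i x < h x) /\ (forall j, j \in t -> h x < b j x).
Proof.
have two (a1 a2 : E -> R) : in_A K a1 -> in_A K a2 -> t != [::] ->
    (forall j, j \in t -> in_A K (b j)) ->
    (forall j x, j \in t -> K x -> a1 x < b j x /\ a2 x < b j x) ->
    exists2 h, in_A K h & forall x, K x ->
      [/\ a1 x < h x, a2 x < h x & forall j, j \in t -> h x < b j x].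
  move=> Aa1 Aa2; elim: t => // j [|k t] IH _ Ab ab.
    have Abj := Ab j (mem_head _ _).
    have [|h Ah hP] := simplex_interpolation2 Aa1 Aa2 Abj Abj.
      by move=> x Kx; have [] := ab j x (mem_head _ _) Kx.
    exists h => // x /hP[? ? ? _]; split=> // i.
    by rewrite inE => /eqP->.
  have [||| h' Ah' hP'] := IH; first by [].
  - by move=> i it; apply: Ab; rewrite inE it orbT.
  - by move=> i x it; apply: ab; rewrite inE it orbT.
  have Abj := Ab j (mem_head _ _).
  have [|h Ah hP] := simplex_interpolation2 Aa1 Aa2 Abj Ah'.
    move=> x Kx; have [? ?] := ab j x (mem_head _ _) Kx.
    by have [? ? _] := hP' x Kx.
  exists h => // x Kx; have [? ? ? hh'] := hP x Kx; split=> // i.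
  rewrite inE => /predU1P[->//|it]; apply: lt_trans hh' _.
  by have [_ _] := hP' x Kx; apply.
move=> + t0; elim: s => // i [|k s] IH _ Aa Ab ab.
  have Aai := Aa i (mem_head _ _).
  have [|h Ah hP] := two _ _ Aai Aai t0 Ab.
    by move=> j x jt Kx; split; exact: ab (mem_head _ _) jt Kx.
  exists h => // x /hP[ha _ hb]; split=> // l.
  by rewrite inE => /eqP->.
have [|||| h' Ah' hP'] := IH; first by [].
- by move=> l ls; apply: Aa; rewrite inE ls orbT.
- exact: Ab.
- by move=> l j x ls; apply: ab; rewrite inE ls orbT.
have Aai := Aa i (mem_head _ _).
have [|h Ah hP] := two _ _ Aai Ah' t0 Ab.
  move=> j x jt Kx; split; first exact: ab (mem_head _ _) jt Kx.
  by have [_] := hP' x Kx; apply.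
exists h => // x Kx; have [ha hh' hb] := hP x Kx; split=> // l.
rewrite inE => /predU1P[->//|ls]; apply: lt_trans hh'.
by have [+ _] := hP' x Kx; apply.
Qed.

End simplex.

(** * Selections of open convex graphs *)

Lemma closure_convex (R : realType) (E : tvsType R) (V : set E) :
  Defs.convex_set V -> Defs.convex_set (closure V).
Proof.
move=> cV x y l Vx Vy l01 B Bz.
have scale_cvg (t : R) : continuous (fun u : E => t *: u).
  move=> u; apply: (@continuous_comp _ _ _ (fun u : E => (t : R^o, u))
    (fun z : R^o * E => z.1 *: z.2)); last exact: scale_continuous.
  by apply: (@cvg_pair _ _ _ _ (nbhs (t : R^o)) (nbhs u));
    [exact: cvg_cst|exact: cvg_id].
have c : continuous (fun p : E * E => l *: p.1 + (1 - l) *: p.2).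
  move=> p; apply: (@continuous_comp _ _ _
    (fun p : E * E => (l *: p.1, (1 - l) *: p.2))
    (fun q : E * E => q.1 + q.2)); last exact: add_continuous.
  apply: (@cvg_pair _ _ _ _ (nbhs (l *: p.1)) (nbhs ((1 - l) *: p.2))).
    by apply: (@continuous_comp _ _ _ fst); [exact: cvg_fst|exact: scale_cvg].
  by apply: (@continuous_comp _ _ _ snd); [exact: cvg_snd|exact: scale_cvg].
have [[A1 A2] /= [A1x A2y] A12] := c (x, y) B Bz.
have [u [Vu A1u]] := Vx A1 A1x; have [v [Vv A2v]] := Vy A2 A2y.
exists (l *: u + (1 - l) *: v); split; first exact: cV.
exact: (A12 (u, v)).
Qed.

(** By regularity there is room to take the closure of a convex neighbourhood inside [U]. Closedness
    is needed for compact cells. *)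
Lemma nbhs_closed_convex (R : realType) (E : tvsType R) (x : E) (U : set E) :
  nbhs x U ->
  exists V, [/\ nbhs x V, V `<=` U, closed V & Defs.convex_set V].
Proof.
move=> /uniform_regular[B Bx BU].
have [V [Vx VB cV]] := nbhs_convex Bx.
exists (closure V); split.
- exact: filterS (@subset_closure _ V) Vx.
- by apply: subset_trans BU; exact: closure_subset.
- exact: closed_closure.
- exact: closure_convex.
Qed.

Section open_convex_graph.
Variables (R : realType) (E : tvsType R) (K : set E).

Definition convex_graph (G : E -> R -> Prop) : Prop :=
  forall x y s t l, K x -> K y -> G x s -> G y t -> 0 <= l <= 1 ->
    G (l *: x + (1 - l) *: y) (l * s + (1 - l) * t).

Definition open_graph (G : E -> R -> Prop) : Prop :=
  forall x s, K x -> G x s -> exists U d, [/\ nbhs x U, 0 < d &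
    forall y t, K y -> U y -> `|t - s| <= d -> G y t].

Lemma convex_graph_between (G : E -> R -> Prop) (x : E) (s t u : R) :
  convex_graph G -> K x -> G x s -> G x t -> s <= u <= t -> G x u.
Proof.
move=> cG Kx Gs Gt /andP[su ut].
have [st|st] := eqVneq s t.
  by have -> : u = s by apply: le_anti; rewrite su st ut.
have st0 : 0 < t - s.
  by rewrite subr_gt0 lt_neqAle st (le_trans su ut).
have := @cG x x s t ((t - u) / (t - s)) Kx Kx Gs Gt.
rewrite -scalerDl subrKC scale1r.
suff -> : (t - u) / (t - s) * s + (1 - (t - u) / (t - s)) * t = u.
  apply; apply/andP; split.
    by rewrite divr_ge0// ?subr_ge0 ?(ltW st0)// -subr_ge0 ltW.
  by rewrite ler_pdivrMr//; lra.
by field; exact: lt0r_neq0.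
Qed.

(** A finite family of horizontal pieces [C i x {t i}] inside [G], whose cells may overlap: a
    multivalued, piecewise constant selection. *)
Definition graph_cover (G : E -> R -> Prop) (s : seq E) (C : E -> set E)
    (t : E -> R) : Prop :=
  (forall i, i \in s -> [/\ compact (C i), Defs.convex_set (C i) & C i !=set0]) /\
  (forall i, i \in s -> forall y, C i y -> K y /\ G y (t i)) /\
  (forall x, K x -> exists2 i, i \in s & C i x).

(** Openness of [G] keeps a height admissible on a whole neighbourhood, and compactness of [K]
    leaves finitely many of these. *)
Lemma exists_graph_cover (G : E -> R -> Prop) :
  compact K -> Defs.convex_set K -> open_graph G ->
  (forall x, K x -> exists t, G x t) ->
  exists s C t, graph_cover G s C t.
Proof.
move=> kK cK oG neG.
have loc x : exists p : set E * R, K x -> [/\ nbhs x p.1, closed p.1,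
    Defs.convex_set p.1 & forall y, K y -> p.1 y -> G y p.2].
  have [Kx|] := pselect (K x); last by exists (setT, 0).
  have [t Gt] := neG x Kx.
  have [U [d [Ux d0 UG]]] := oG x t Kx Gt.
  have [V [Vx VU Vcl cV]] := nbhs_closed_convex Ux.
  exists (V, t) => _; split=> // y Ky /VU Uy; apply: UG => //.
  by rewrite subrr normr0 ltW.
have [f fP] := choice loc.
have [|s [sK sP]] := @compact_finite_subcover _ K (fun x => (f x).1) kK.
  by move=> x /fP[].
exists s, (fun x => K `&` (f x).1), (fun x => (f x).2); split; [|split].
- move=> i /sK Ki; have [ni cli ci _] := fP i Ki; split.
  + exact: compact_closedI.
  + by move=> x y l [Kx fx] [Ky fy] l01; split; [exact: cK|exact: ci].
  + by exists i; split=> //; exact: nbhs_singleton.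
- move=> i /sK Ki y [Ky fy]; have [_ _ _ fG] := fP i Ki.
  by split=> //; exact: fG.
- by move=> x Kx; have [i si fi] := sP x Kx; exists i.
Qed.

(* a separates the hull of the sets C_i x [t_i, N] from a point of G over x
   lying below that hull. *)
Lemma affine_below_cover (G : E -> R -> Prop) s C t (x : E) :
  compact_convex K -> convex_graph G -> open_graph G ->
  graph_cover G s C t -> K x ->
  exists a, [/\ in_A K a, G x (a x) &
    forall i, i \in s -> forall y, C i y -> a y < t i].
Proof.
move=> [hE [kK [cK _]]] cG oG [sC [CG Ccov]] Kx.
have [i0 si0 Ci0] := Ccov x Kx.
(* A common ceiling, which keeps the columns above the pieces compact. *)
have [N tN] : exists N, forall i, i \in s -> t i <= N.
  elim: s {sC CG Ccov i0 si0 Ci0} => [|j s [N IH]]; first by exists 0.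
  exists (Num.max (t j) N) => i; rewrite inE le_max => /predU1P[->|/IH->].
    by rewrite lexx.
  by rewrite orbT.
pose B i : set (E * R^o) := C i `*` [set` `[t i, N]].
have [||D [kD cD BD minD]] := @exists_finite_hull _ (E * R^o)%type _ s B.
- by apply: contraTneq si0 => ->.
- move=> i si; have [kC cC [y Cy]] := sC i si; split.
  + by apply: compact_setX => //; exact: segment_compact.
  + move=> [u p] [v q] l [/= Cu up] [/= Cv vq] l01; split; first exact: cC.
    move: up vq l01; rewrite /= !in_itv/= => /andP[? ?] /andP[? ?] /andP[? ?].
    by rewrite /GRing.scale/=; apply/andP; split; nra.
  + by exists (y, t i); split=> //=; rewrite in_itv/= lexx tN.
(* The points strictly above some point of [G]. This convex set contains every column, since
   openness allows lowering [t i] by [d]; so it contains [D], and the lowest point of [D] over [x]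
   has a point [(x, r)] of [G] strictly beneath it. *)
pose W : set (E * R^o) := [set p | K p.1 /\ exists2 r, r < p.2 & G p.1 r].
have cW : Defs.convex_set W.
  move=> [u p] [v q] l [/= Ku [r rp Gr]] [/= Kv [r' rq Gr']] l01.
  split=> /=; first exact: cK.
  exists (l * r + (1 - l) * r'); last exact: cG.
  have /andP[l0 l1] := l01; rewrite /GRing.scale/=.
  have [->|ln0] := eqVneq l 0; first by rewrite !mul0r !add0r subr0 !mul1r.
  have lp : 0 < l by rewrite lt_neqAle eq_sym ln0.
  by nra.
have DW : D `<=` W.
  apply: minD => // i si [y r] [/= Cy]; rewrite in_itv/= => /andP[tr rN].
  have [Ky Gy] := CG i si y Cy.
  have [U [d [Uy d0 UG]]] := oG y _ Ky Gy.
  split=> //=; exists (t i - d); first lra.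
  apply: UG => //; first exact: nbhs_singleton.
  by rewrite addrAC subrr add0r normrN gtr0_norm.
pose S := D `&` [set p | p.1 = x].
have kS : compact S.
  apply: compact_closedI => //.
  have cx : closed [set x] by apply: compact_closed hE _; exact: compact_set1.
  exact: (continuous_closedP _).1 (fun p => cvg_fst) _ cx.
have S0 : S !=set0.
  exists (x, N); split=> //; apply: (BD i0 si0); split=> //=.
  by rewrite in_itv/= lexx tN.
have [[x' s0] /set_mem[Ds0 /= xx'] smin] :=
  @compact_EVT_min _ _ (fun p : E * R^o => p.2 : R) S S0 kS
    (continuous_subspaceT (fun p => cvg_snd)).
subst x'; have [_ [/= r rs0 Gr]] := DW _ Ds0.
have k1 : compact [set (x, r : R^o)] by exact: compact_set1.
have [|||h [hc ha hr hD]] := @separate_above_below _ _ _ D hE k1 _ kD cD.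
- by move=> _ _ l -> -> _; rewrite -scalerDl subrKC scale1r.
- move=> p -> Dr; have := smin (x, r) (mem_set (conj Dr erefl)).
  by move=> /=; rewrite leNgt rs0.
- by exists x, r, s0.
have hx : r < h x := hr _ erefl.
have ht i y : i \in s -> C i y -> h y < t i.
  move=> si Cy; apply: (hD (y, t i)); apply: (BD i si); split=> //=.
  by rewrite in_itv/= lexx tN.
exists h; split.
- split; first by move=> u v l _ _ _; exact: ha.
  exact: continuous_subspaceT.
(* [h x] lies between [r] and [t i0], both in the fibre over [x], which is an interval. *)
- have [_ Gx] := CG i0 si0 x Ci0.
  by apply: (convex_graph_between cG Kx Gr Gx); rewrite ltW//= ltW// ht.
- by move=> i si y; exact: ht.
Qed.

(** The function built for [x] stays in [G] near [x], by continuity and openness, so finitely many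
    suffice over [K]. *)
Lemma affine_family_below_cover (G : E -> R -> Prop) s C t :
  compact_convex K -> convex_graph G -> open_graph G -> graph_cover G s C t ->
  exists (s' : seq E) a, [/\ s' != [::], forall i, i \in s' -> in_A K (a i),
    forall x, K x -> exists2 i, i \in s' & G x (a i x) &
    forall i j y, i \in s' -> j \in s -> C j y -> a i y < t j].
Proof.
move=> kK cG oG sC.
have loc x : exists a, K x -> [/\ in_A K a, G x (a x) &
    forall i, i \in s -> forall y, C i y -> a y < t i].
  have [Kx|] := pselect (K x); last by exists (fun=> 0).
  by have [a aP] := affine_below_cover kK cG oG sC Kx; exists a.
have [a aP] := choice loc.
have [_ [kK' [_ [x0 Kx0]]]] := kK.
have [|s' [s'K s'P]] :=
    @compact_finite_subcover _ K (fun x => [set y | K y -> G y (a x y)]) kK'.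
  move=> x Kx; have [[_ /within_continuous_realP ca] Gx _] := aP x Kx.
  have [U [d [Ux d0 UG]]] := oG x _ Kx Gx.
  have [V Vx VP] := ca x Kx d d0.
  apply: filterS (filterI Ux Vx) => y [Uy Vy] Ky.
  by apply: UG => //; rewrite ltW// VP.
exists s', a; split.
- by have [i + _] := s'P x0 Kx0; apply: contraTneq => ->.
- by move=> i /s'K/aP[].
- by move=> x Kx; have [i si Gi] := s'P x Kx; exists i => //; exact: Gi.
- by move=> i j y /s'K/aP[_ _ +] sj Cy; apply.
Qed.

End open_convex_graph.

(** An interpolant between a lower and an upper affine family works, because over each point some
    member of either family is in the fibre and fibres are intervals. *)
Lemma simplex_open_selection (R : realType) (E : tvsType R) (K : set E)
    (G : E -> R -> Prop) :
  choquet_simplex K -> convex_graph K G -> open_graph K G ->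
  (forall x, K x -> exists t, G x t) ->
  exists2 h, in_A K h & forall x, K x -> G x (h x).
Proof.
move=> sK cG oG neG; have [kcK _] := sK; have [_ [kK [cK _]]] := kcK.
have [s [C [t sC]]] := exists_graph_cover kK cK oG neG.
have [s1 [a [s10 Aa aG aC]]] := affine_family_below_cover kcK cG oG sC.
(* The upper family comes from the lower one for the reflected graph, with the same cells and
   heights [- t i]. *)
pose G' x r := G x (- r).
have cG' : convex_graph K G'.
  move=> x y p q l Kx Ky Gp Gq l01; rewrite /G' opprD -!mulrN; exact: cG.
have oG' : open_graph K G'.
  move=> x p Kx Gp; have [U [d [Ux d0 UG]]] := oG _ _ Kx Gp.
  exists U, d; split=> // y q Ky Uy qp; apply: UG => //.
  by rewrite -opprD normrN -[p]opprK addrC opprK; rewrite addrC.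
have sC' : graph_cover K G' s C (fun i => - t i).
  have [C1 [C2 C3]] := sC; split=> //; split=> // i si y Cy.
  by rewrite /G' opprK; exact: C2.
have [s2 [b [s20 Ab bG bC]]] := affine_family_below_cover kcK cG' oG' sC'.
have [||h Ah hP] :=
    @simplex_interpolation _ _ _ sK _ _ s1 s2 a (fun i x => - b i x) s10 s20 Aa.
- by move=> j /Ab; exact: in_AN.
(* The height [t k] of a cell containing [x] separates the two families there. *)
- move=> i j x si sj Kx; have [k sk Ck] := sC.2.2 x Kx.
  by have := aC i k x si sk Ck; have := bC j k x sj sk Ck; lra.
exists h => // x Kx; have [h1 h2] := hP x Kx.
have [i si Gi] := aG x Kx; have [j sj Gj] := bG x Kx.
by apply: (convex_graph_between cG Kx Gi Gj); rewrite !ltW ?h1 ?h2.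
Qed.

(** * Lower semicontinuous selections *)

Section selection.
Variables (R : realType) (E : tvsType R) (K : set E) (T : Type) (Y : set T).

(** Uniform distance as a pointwise bound, so that no supremum has to be shown finite. *)
Definition uclose (e : R) (v w : T -> R) : Prop :=
  forall y, Y y -> `|v y - w y| <= e.

Definition ubounded (v : T -> R) : Prop :=
  exists M, forall y, Y y -> `|v y| <= M.

Definition affine_uniform (g : E -> T -> R) : Prop :=
  (forall x x' l y, K x -> K x' -> 0 <= l <= 1 -> Y y ->
    g (l *: x + (1 - l) *: x') y = l * g x y + (1 - l) * g x' y) /\
  (forall x, K x -> forall e, 0 < e -> exists2 U, nbhs x U &
    forall x', K x' -> U x' -> uclose e (g x') (g x)).

Definition convex_relation (G : E -> (T -> R) -> Prop) : Prop :=
  forall x x' v w l, K x -> K x' -> G x v -> G x' w -> 0 <= l <= 1 ->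
    G (l *: x + (1 - l) *: x') (fun y => l * v y + (1 - l) * w y).

Definition open_relation (G : E -> (T -> R) -> Prop) : Prop :=
  forall x v, K x -> G x v -> exists U d, [/\ nbhs x U, 0 < d &
    forall x' w, K x' -> U x' -> uclose d w v -> G x' w].

Definition lsc_relation (G : E -> (T -> R) -> Prop) : Prop :=
  forall x v, K x -> G x v -> forall e, 0 < e -> exists2 U, nbhs x U &
    forall x', K x' -> U x' -> exists2 w, G x' w & uclose e w v.

Lemma uclose_trans (v : T -> R) (d e : R) (u w : T -> R) :
  uclose d u v -> uclose e v w -> uclose (d + e) u w.
Proof.
move=> uv vw y Yy; rewrite -(subrKA (v y)).
by apply: le_trans (ler_normD _ _) _; apply: lerD; [exact: uv|exact: vw].
Qed.

Lemma uclose_sym (e : R) (v w : T -> R) : uclose e v w -> uclose e w v.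
Proof. by move=> vw y Yy; rewrite distrC; exact: vw. Qed.

Lemma uclose_le (e d : R) (v w : T -> R) : d <= e -> uclose d v w -> uclose e v w.
Proof. by move=> de vw y Yy; apply: le_trans (vw y Yy) de. Qed.

Lemma uclose_refl (e : R) (v : T -> R) : 0 <= e -> uclose e v v.
Proof. by move=> e0 y Yy; rewrite subrr normr0. Qed.

Lemma uclose_convex (e : R) (v v' w w' : T -> R) (l : R) : 0 <= l <= 1 ->
  uclose e v w -> uclose e v' w' ->
  uclose e (fun y => l * v y + (1 - l) * v' y)
           (fun y => l * w y + (1 - l) * w' y).
Proof.
move=> /andP[l0 l1] vw vw' y Yy; have := vw y Yy; have := vw' y Yy.
rewrite !ler_norml => /andP[h1 h2] /andP[h3 h4].
by apply/andP; split; nra.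
Qed.

Lemma uclose_scale (M d : R) (v w w' : T -> R) (t t' : R) :
  (forall y, Y y -> `|v y| <= M) -> 0 < M -> 0 < d ->
  `|t' - t| <= d / M / 2 -> uclose (d / 2) w' w ->
  uclose d (fun y => t' * v y + w' y) (fun y => t * v y + w y).
Proof.
move=> vM M0 d0 tt ww y Yy.
have -> : t' * v y + w' y - (t * v y + w y) = (t' - t) * v y + (w' y - w y).
  by ring.
apply: le_trans (ler_normD _ _) _; rewrite normrM [leRHS](splitr d).
apply: lerD; last exact: ww.
have -> : d / 2 = d / M / 2 * M by field; exact: lt0r_neq0.
by apply: ler_pM; rewrite ?normr_ge0 ?vM.
Qed.

(** * Selections with values in a finite-dimensional span *)

Section finite_dimensional.
Hypothesis sK : choquet_simplex K.
Variables (I : Type) (v : I -> T -> R).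
Hypothesis vb : forall i, ubounded (v i).

(** The linear span, in a form that exposes one coefficient at a time. *)
Fixpoint fspan (s : seq I) (w : T -> R) : Prop :=
  if s is i :: s then
    exists t w', fspan s w' /\ w = (fun y => t * v i y + w' y)
  else w = (fun=> 0).

Lemma fspan_convex (s : seq I) (w w' : T -> R) (l : R) :
  fspan s w -> fspan s w' -> fspan s (fun y => l * w y + (1 - l) * w' y).
Proof.
elim: s w w' => [w w' -> ->|i s IH w w'].
  by apply/funext => y; rewrite !mulr0 addr0.
move=> [t [u [su ->]]] [t' [u' [su' ->]]].
exists (l * t + (1 - l) * t'), (fun y => l * u y + (1 - l) * u' y).
by split; [exact: IH|apply/funext => y; ring].
Qed.

(** Induction on the number of generators: the first coefficient is selected by the scalar case, and
    the rest is selected from the relation translated by it. *)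
Lemma fspan_selection (s : seq I) (G : E -> (T -> R) -> Prop) :
  convex_relation G -> open_relation G ->
  (forall x, K x -> exists2 w, fspan s w & G x w) ->
  exists2 g, affine_uniform g & forall x, K x -> G x (g x).
Proof.
elim: s G => [|i s IH] G cG oG neG.
  exists (fun _ _ => 0); last by move=> x /neG[w ->].
  split=> [x x' l y *|x Kx e e0]; first by rewrite !mulr0 addr0.
  by exists setT; [exact: filterT|move=> *; exact/uclose_refl/ltW].
(* The maximum with 1 makes [M] positive, as the tolerance [d / M / 2] requires. *)
have [M0 vM0] := vb i; pose M := Num.max M0 1.
have Mp : 0 < M by rewrite lt_max ltr01 orbT.
have vM y : Y y -> `|v i y| <= M by move=> /vM0 h; rewrite le_max h.
(* The projection of [G] to its first coefficient is again open and convex, with nonempty fibres. *)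
pose G1 x t := exists2 w, fspan s w & G x (fun y => t * v i y + w y).
have [|||h [ha hc] hG] := @simplex_open_selection _ _ _ G1 sK.
- move=> x x' t t' l Kx Kx' [w sw Gw] [w' sw' Gw'] l01.
  exists (fun y => l * w y + (1 - l) * w' y); first exact: fspan_convex.
  have := cG _ _ _ _ _ Kx Kx' Gw Gw' l01.
  by congr (G _ _); apply/funext => y; ring.
- move=> x t Kx [w sw Gw]; have [U [d [Ux d0 UG]]] := oG _ _ Kx Gw.
  exists U, (d / M / 2); split=> //; first by rewrite !divr_gt0.
  move=> x' t' Kx' Ux' tt; exists w => //; apply: UG => //.
  by apply: (uclose_scale vM) => //; apply: uclose_refl; rewrite ltW// divr_gt0.
- by move=> x /neG[_ [t [w [sw ->]]] Gw]; exists t, w.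
pose G2 x w := G x (fun y => h x * v i y + w y).
have [|||g [ga gc] gG] := IH G2.
- move=> x x' w w' l Kx Kx' Gw Gw' l01.
  have := cG _ _ _ _ _ Kx Kx' Gw Gw' l01; rewrite /G2 ha//.
  by congr (G _ _); apply/funext => y; rewrite /GRing.scale/=; ring.
- move=> x w Kx Gw; have [U [d [Ux d0 UG]]] := oG _ _ Kx Gw.
  have dM : 0 < d / M / 2 by rewrite !divr_gt0.
  have [V Vx VP] := (within_continuous_realP _ _).1 hc x Kx _ dM.
  exists (U `&` V), (d / 2); split; [exact: filterI|by rewrite divr_gt0|].
  move=> x' w' Kx' [Ux' Vx'] ww; apply: UG => //.
  by apply: (uclose_scale vM) => //; exact/ltW/VP.
- by move=> x /hG[w sw Gw]; exists w.
exists (fun x y => h x * v i y + g x y); last exact: gG.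
split=> [x x' l y Kx Kx' l01 Yy|x Kx e e0].
  by rewrite ha// ga// /GRing.scale/=; ring.
have eM : 0 < e / M / 2 by rewrite !divr_gt0.
have [V Vx VP] := (within_continuous_realP _ _).1 hc x Kx _ eM.
have [U Ux UP] := gc x Kx (e / 2) ltac:(lra).
exists (U `&` V); first exact: filterI.
move=> x' Kx' [Ux' Vx']; apply: (uclose_scale vM) => //; first exact/ltW/VP.
exact: UP.
Qed.

End finite_dimensional.

Lemma fspan_mem (I : eqType) (v : I -> T -> R) (s : seq I) (i : I) :
  i \in s -> fspan v s (v i).
Proof.
have fspan0 s' : fspan v s' (fun=> 0).
  elim: s' => // j s' IH; exists 0, (fun=> 0); split=> //.
  by apply/funext => y; rewrite mul0r addr0.
elim: s => // j s IH; rewrite inE => /predU1P[->|/IH si].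
  exists 1, (fun=> 0); split=> //.
  by apply/funext => y; rewrite mul1r addr0.
by exists 0, (v i); split=> //; apply/funext => y; rewrite mul0r add0r.
Qed.

(** * From approximate selections to selections up to closure *)

Section lsc.
Hypothesis sK : choquet_simplex K.

(** By lower semicontinuity and compactness, finitely many values meet the [e]-neighbourhood of
    [Phi] over all of [K]; their span reduces the problem to finite dimension. *)
Lemma approximate_selection (Phi : E -> (T -> R) -> Prop) (e : R) : 0 < e ->
  convex_relation Phi -> lsc_relation Phi ->
  (forall x, K x -> exists v, Phi x v) ->
  (forall x v, K x -> Phi x v -> ubounded v) ->
  exists2 g, affine_uniform g &
    forall x, K x -> exists2 v, Phi x v & uclose e (g x) v.
Proof.
move=> e0 cP lP neP bP; have [[_ [kK _]] _] := sK.
(* The strict [e' < e] makes this an open neighbourhood of [Phi]: a third of the slack absorbs the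
   change of [v], another the change of [w]. *)
pose G x v := exists w e', [/\ Phi x w, e' < e & uclose e' v w].
have cG : convex_relation G.
  move=> x x' v v' l Kx Kx' [w [d [Pw de vw]]] [w' [d' [Pw' de' vw']]] l01.
  exists (fun y => l * w y + (1 - l) * w' y), (Num.max d d'); split.
  - exact: cP.
  - by rewrite gt_max de de'.
  - apply: uclose_convex => //; [apply: uclose_le vw|apply: uclose_le vw'];
      by rewrite le_max lexx ?orbT.
have oG : open_relation G.
  move=> x v Kx [w [d [Pw de vw]]].
  have h0 : 0 < (e - d) / 3 by rewrite divr_gt0// subr_gt0.
  have [U Ux UP] := lP x w Kx Pw _ h0.
  exists U, ((e - d) / 3); split=> // x' v' Kx' Ux' vv.
  have [w' Pw' ww] := UP x' Kx' Ux'.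
  exists w', ((e - d) / 3 + d + (e - d) / 3); split=> //; first lra.
  exact: uclose_trans (uclose_trans vv vw) (uclose_sym ww).
have loc x : exists w, ubounded w /\ (K x -> Phi x w).
  have [Kx|] := pselect (K x); last first.
    by exists (fun=> 0); split=> //; exists 0 => y _; rewrite normr0.
  by have [w Pw] := neP x Kx; exists w; split=> //; exact: bP Pw.
have [w wP] := choice loc.
have [|s [sK' sP]] :=
    @compact_finite_subcover _ K (fun x => [set x' | K x' -> G x' (w x)]) kK.
  move=> x Kx; have [_ /(_ Kx) Pw] := wP x.
  have [U Ux UP] := lP x _ Kx Pw (e / 2) ltac:(lra).
  apply: filterS Ux => x' Ux' Kx'; have [w' Pw' ww] := UP x' Kx' Ux'.
  by exists w', (e / 2); split=> //; [lra|exact: uclose_sym].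
have [||g ag gG] := @fspan_selection sK _ w _ s G cG oG.
- by move=> x; have [] := wP x.
- move=> x Kx; have [i si Gi] := sP x Kx.
  by exists (w i); [exact: fspan_mem|exact: Gi].
exists g => // x Kx; have [u [d [Pu de gu]]] := gG x Kx.
by exists u => //; apply: uclose_le gu; exact: ltW.
Qed.

(** The ball is open and its centre moves continuously; the slack [e - d] pays for the perturbation
    of both the value and the centre. *)
Lemma lsc_relation_ball (Phi : E -> (T -> R) -> Prop) (g : E -> T -> R) (e : R) :
  lsc_relation Phi -> affine_uniform g ->
  lsc_relation (fun x v => Phi x v /\ exists2 d, d < e & uclose d v (g x)).
Proof.
move=> lP [_ gc] x v Kx [Pv [d de vg]] r r0.
pose h := Num.min r ((e - d) / 3).
have h0 : 0 < h by rewrite lt_min r0 divr_gt0// subr_gt0.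
have he : h <= (e - d) / 3 by rewrite ge_min lexx orbT.
have [U Ux UP] := lP x v Kx Pv h h0.
have [V Vx VP] := gc x Kx h h0.
exists (U `&` V); first exact: filterI.
move=> x' Kx' [Ux' Vx']; have [w Pw wv] := UP x' Kx' Ux'.
exists w; last by apply: uclose_le wv; rewrite ge_min lexx.
split=> //; exists (h + d + h); first lra.
apply: uclose_trans (uclose_trans wv vg) _.
exact/uclose_sym/VP.
Qed.

Lemma convex_relation_ball (Phi : E -> (T -> R) -> Prop) (g : E -> T -> R) (e : R) :
  convex_relation Phi -> affine_uniform g ->
  convex_relation (fun x v => Phi x v /\ exists2 d, d < e & uclose d v (g x)).
Proof.
move=> cP [ga _] x x' v v' l Kx Kx' [Pv [d de vg]] [Pv' [d' de' vg']] l01.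
split; first exact: cP.
exists (Num.max d d'); first by rewrite gt_max de de'.
move=> y Yy; rewrite ga//; move: y Yy; apply: uclose_convex => //.
  by apply: uclose_le vg; rewrite le_max lexx.
by apply: uclose_le vg'; rewrite le_max lexx orbT.
Qed.

Lemma affine_uniform_limit (h : E -> T -> R) :
  Defs.convex_set K ->
  (forall e, 0 < e -> exists2 g, affine_uniform g &
    forall x, K x -> uclose e (g x) (h x)) ->
  affine_uniform h.
Proof.
move=> cK gh; split=> [x x' l y Kx Kx' l01 Yy|x Kx e e0].
  apply/eqP; rewrite -subr_eq0 -normr_le0; apply/ler_addgt0Pl => e e0.
  rewrite addr0; have [g [ga _] gn] := gh (e / 2) ltac:(lra).
  have -> : h (l *: x + (1 - l) *: x') y - (l * h x y + (1 - l) * h x' y) =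
    (h (l *: x + (1 - l) *: x') y - g (l *: x + (1 - l) *: x') y) +
    ((l * g x y + (1 - l) * g x' y) - (l * h x y + (1 - l) * h x' y)).
    by rewrite ga//; ring.
  apply: le_trans (ler_normD _ _) _; rewrite [leRHS](splitr e); apply: lerD.
    by rewrite distrC; apply: gn => //; exact: cK.
  by apply: (@uclose_convex _ (g x) (g x') (h x) (h x')) => //; exact: gn.
have [g [_ gc] gn] := gh (e / 3) ltac:(lra).
have [U Ux UP] := gc x Kx (e / 3) ltac:(lra).
exists U => // x' Kx' Ux'; apply: (@uclose_le _ (e / 3 + e / 3 + e / 3)).
  lra.
apply: uclose_trans (gn x Kx); apply: uclose_trans (UP x' Kx' Ux').
exact/uclose_sym/gn.
Qed.

(** Michael's iteration. Values of [Phi] are not assumed closed, so the limit is only claimed to lie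
    in their uniform closure. *)
Lemma lsc_selection (Phi : E -> (T -> R) -> Prop) :
  convex_relation Phi -> lsc_relation Phi ->
  (forall x, K x -> exists v, Phi x v) ->
  (forall x v, K x -> Phi x v -> ubounded v) ->
  exists2 g, affine_uniform g &
    forall x, K x -> forall e, 0 < e -> exists2 v, Phi x v & uclose e (g x) v.
Proof.
move=> cP lP neP bP; have [[_ [_ [cK _]]] _] := sK.
pose eps n : R := 2^-1 ^+ n.
have eps0 n : 0 < eps n by rewrite exprn_gt0// invr_gt0.
have epsS n : eps n.+1 = eps n / 2 by rewrite /eps exprS mulrC.
pose P n (g : E -> T -> R) := affine_uniform g /\
  forall x, K x -> exists2 v, Phi x v & uclose (eps n) (g x) v.
(* The premise sits inside the existential so that choice yields a total function, which can then be
   iterated by plain recursion. *)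
have step (p : nat * (E -> T -> R)) : exists g', P p.1 p.2 ->
    P p.1.+1 g' /\ forall x, K x -> uclose (3 * eps p.1) (g' x) (p.2 x).
  case: p => n g /=; have [[ag gP]|] := pselect (P n g); last by exists g.
  (* The radius [2 * eps n] exceeds the error [eps n] of [g], so the ball meets [Phi]. The new
     function is then within [eps n / 2 + 2 * eps n <= 3 * eps n] of the old one. *)
  have [x Kx|x v Kx [Pv _]|g' ag' g'P] := approximate_selection (eps0 n.+1)
    (convex_relation_ball (e := 2 * eps n) cP ag) (lsc_relation_ball lP ag).
  - have [v Pv gv] := gP x Kx; exists v; split=> //.
    by exists (eps n); [have := eps0 n; lra|exact: uclose_sym].
  - exact: bP Pv.
  exists g' => _; split.
    by split=> // x Kx; have [v [Pv _] gv] := g'P x Kx; exists v.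
  move=> x Kx; have [v [_ [d de vg]] g'v] := g'P x Kx.
  apply: uclose_le (uclose_trans g'v vg).
  by rewrite epsS; have := eps0 n; lra.
have [f fP] := choice step.
have [g0 ag0 g0P] := approximate_selection (eps0 0) cP lP neP bP.
pose g := fix g n := if n is m.+1 then f (m, g m) else g0.
have gP n : P n (g n) by elim: n => // n IH; exact: (fP (n, g n) IH).1.
have gS n x : K x -> uclose (3 * eps n) (g n.+1 x) (g n x).
  exact: (fP (n, g n) (gP n)).2.
(* The sum of the remaining steps [3 * eps k] for [k >= n]. *)
pose c n := 6 * eps n.
have cS n : 3 * eps n = c n - c n.+1 by rewrite /c epsS; field.
have gD n k x : K x -> uclose (c n - c (n + k)%N) (g (n + k)%N x) (g n x).
  move=> Kx; elim: k => [|k IH]; first by rewrite addn0 subrr; exact: uclose_refl.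
  rewrite addnS; apply: uclose_le (uclose_trans (gS _ _ Kx) IH).
  by rewrite cS; lra.
have c0 n : 0 < c n by rewrite mulr_gt0.
have gle n m x y : K x -> Y y -> g n x y - c n <= g m x y + c m.
  move=> Kx Yy; have := c0 n; have := c0 m.
  have [/subnKC <-|/ltnW/subnKC <-] := leqP n m.
    have := gD n (m - n)%N x Kx y Yy; rewrite ler_norml => /andP[]; lra.
  have := gD m (n - m)%N x Kx y Yy; rewrite ler_norml => /andP[]; lra.
(* The pointwise limit, taken as the supremum of the lower estimates [g n x y - c n], each of which
   is below every upper estimate [g m x y + c m]. *)
pose h x y := sup [set g n x y - c n | n in [set: nat]].
have gh n x : K x -> uclose (c n) (g n x) (h x).
  move=> Kx y Yy; rewrite ler_distlC; apply/andP; split.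
    apply: ub_le_sup; last by exists n.
    by exists (g 0%N x y + c 0%N) => _ [m _ <-]; exact: gle.
  apply: ge_sup; first by exists (g 0%N x y - c 0%N), 0%N.
  by move=> _ [m _ <-]; exact: gle.
have csmall e : 0 < e -> exists n, c n <= e.
  move=> e0; have e6 : 0 < e / 6 by lra.
  have [n _ /(_ n (leqnn n))] := near_infty_natSinv_expn_lt (PosNum e6).
  rewrite /= div1r -exprVn => en; exists n; rewrite /c /eps; lra.
exists h.
  apply: affine_uniform_limit cK _ => e /csmall[n cn].
  by exists (g n); [exact: (gP n).1|move=> x Kx; apply: uclose_le (gh n x Kx)].
move=> x Kx e e0; have [n cn] := csmall (e / 2) ltac:(lra).
have [v Pv gv] := (gP n).2 x Kx; exists v => //.
apply: uclose_le (uclose_trans (uclose_sym (gh n x Kx)) gv).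
have := eps0 n; move: cn; rewrite /c; lra.
Qed.

End lsc.
End selection.

(** * Extension from a closed face *)

Section affine_function_space.
Variables (R : realType) (E : tvsType R) (K : set E).

(** Scalar functions are the one-point case of [affine_uniform], so [affine_uniform_limit] covers
    uniform limits in the space of affine functions too. *)
Lemma in_A_unitP (h : E -> R) :
  in_A K h <-> affine_uniform K [set: unit] (fun x _ => h x).
Proof.
split=> [[ha /within_continuous_realP hc]|[ha hc]].
  split=> [x x' l _ Kx Kx' l01 _|x Kx e e0]; first by rewrite ha.
  have [U Ux UP] := hc x Kx e e0.
  by exists U => // x' Kx' Ux' _ _; exact/ltW/UP.
split; first by move=> x y l Kx Ky l01; rewrite (ha _ _ _ tt).
apply/within_continuous_realP => x Kx e e0.
have [U Ux UP] := hc x Kx (e / 2) ltac:(lra).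
exists U => // y Ky Uy; apply: le_lt_trans (UP y Ky Uy tt I) _; lra.
Qed.

Lemma in_A_limit (h : E -> R) : Defs.convex_set K ->
  (forall e, 0 < e -> exists2 v, in_A K v & uclose K e v h) -> in_A K h.
Proof.
move=> cK hP; apply/in_A_unitP/affine_uniform_limit => // e e0.
have [v /in_A_unitP Av vh] := hP e e0.
by exists (fun x _ => v x) => // x Kx _ _; exact: vh.
Qed.

Lemma in_A_conv (v w : E -> R) (l : R) : in_A K v -> in_A K w ->
  in_A K (fun x => l * v x + (1 - l) * w x).
Proof.
move=> Av Aw; apply: in_A_scaleD => //.
have := in_A_scaleD (1 - l) Aw (in_A0 K).
by under eq_fun do rewrite addr0.
Qed.

Lemma in_A_ubounded (v : E -> R) : compact_convex K -> in_A K v -> ubounded K v.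
Proof.
move=> [_ [kK [_ K0]]] [_ cv].
have [a _ amax] := compact_EVT_max K0 kK cv.
have [b _ bmin] := compact_EVT_min K0 kK cv.
exists (`|v a| + `|v b|) => y /mem_set Ky.
have := amax y Ky; have := bmin y Ky.
have := ler_norm (v a); have := ler_norm (- v b).
have := normr_ge0 (v a); have := normr_ge0 (v b).
rewrite normrN ler_norml => *; apply/andP; split; lra.
Qed.

(** Boundedness has to be supplied, as [sup] of an unbounded set is 0 by convention. *)
Lemma supnorm_ge (v : E -> R) (y : E) : ubounded K v -> K y ->
  `|v y| <= supnorm K v.
Proof.
move=> [M vM] Ky; apply: ub_le_sup; last by exists y.
by exists M => _ [z Kz <-]; exact: vM.
Qed.

Lemma supnorm_le (v : E -> R) (M : R) : K !=set0 ->
  (forall y, K y -> `|v y| <= M) -> supnorm K v <= M.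
Proof.
move=> [y Ky] vM; apply: ge_sup; first by exists `|v y|, y.
by move=> _ [z Kz <-]; exact: vM.
Qed.

Lemma supnorm_eq (v w : E -> R) : (forall y, K y -> v y = w y) ->
  supnorm K v = supnorm K w.
Proof.
move=> vw; congr sup; apply/seteqP.
by split=> _ [y Ky <-]; exists y => //; rewrite vw.
Qed.

End affine_function_space.

(** * Norms of affine maps into the space of affine functions *)

Section vector_valued.
Variables (R : realType) (E1 E2 : tvsType R) (K2 : set E2).
Hypothesis kcK2 : compact_convex K2.

(** Near each point [f] varies by at most 1, so finitely many bounded values of [f] control it on
    all of [L]. *)
Lemma in_AA_bounded (L : set E1) (f : E1 -> E2 -> R) :
  compact L -> in_AA L K2 f ->
  exists N, forall k, L k -> forall y, K2 y -> `|f k y| <= N.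
Proof.
move=> kL [fA _ fc].
have fB k k' : L k -> L k' -> ubounded K2 (fun x => f k' x - f k x).
  move=> Lk Lk'; apply: in_A_ubounded => //.
  have := in_A_scaleD (-1) (fA k Lk) (fA k' Lk').
  by under eq_fun do rewrite mulN1r addrC.
have [|s [sL sP]] :=
    @compact_finite_subcover _ L
      (fun k => [set k' | L k' -> uclose K2 1 (f k') (f k)]) kL.
  move=> k Lk; have [U [Uk UP]] := fc k Lk 1 ltr01.
  apply: filterS Uk => k' Uk' Lk' y Ky.
  apply: le_trans (ltW (UP k' Lk' Uk')).
  exact: (@supnorm_ge _ _ _ (fun x => f k' x - f k x)) (fB k k' Lk Lk') Ky.
have [N NP] : exists N, forall k, k \in s -> forall y, K2 y -> `|f k y| <= N.
  elim: s sL {sP} => [|k s IH] sL; first by exists 0.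
  have [|N NP] := IH; first by move=> k' ks; apply: sL; rewrite inE ks orbT.
  have [N' N'P] := in_A_ubounded kcK2 (fA k (sL k (mem_head _ _))).
  exists (Num.max N' N) => k'; rewrite inE => /predU1P[->|ks] y Ky.
    by rewrite le_max N'P.
  by rewrite le_max NP// orbT.
exists (1 + N) => k Lk y Ky; have [k' sk' kk'] := sP k Lk.
rewrite -[f k y](subrK (f k' y)).
by apply: le_trans (ler_normD _ _) _; rewrite lerD ?NP//; exact: kk'.
Qed.

Lemma supnorm_AA_ge (L : set E1) (f : E1 -> E2 -> R) (N : R) :
  (forall k, L k -> forall y, K2 y -> `|f k y| <= N) ->
  forall k, L k -> supnorm K2 (f k) <= supnorm_AA L K2 f.
Proof.
move=> fN k Lk; apply: ub_le_sup; last by exists k.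
exists N => _ [k' Lk' <-]; apply: supnorm_le; last exact: fN.
by have [_ [_ []]] := kcK2.
Qed.

(** Covers the empty face, where the norm of [f] is 0 and only the zero extension is possible. *)
Lemma supnorm_AA_set0 (f : E1 -> E2 -> R) : supnorm_AA set0 K2 f = 0.
Proof. by rewrite /supnorm_AA image_set0 sup0. Qed.

End vector_valued.

Unset Implicit Arguments.

Theorem theorem9 (R : realType) (E1 E2 : tvsType R)
    (K1 : set E1) (K2 : set E2) (F : set E1) (f : E1 -> E2 -> R) :
  choquet_simplex K1 -> choquet_simplex K2 ->
  is_face K1 F -> closed F ->
  in_AA F K2 f -> nonneg_AA F K2 f ->
  exists g : E1 -> E2 -> R,
    [/\ in_AA K1 K2 g, nonneg_AA K1 K2 g,
        (forall k, F k -> forall x, K2 x -> g k x = f k x) &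
        supnorm_AA K1 K2 g = supnorm_AA F K2 f].
Proof.
move=> sK1 [kcK2 _] [FK1 [cF faceF]] clF fAA f0.
have [[_ [kK1 [cK1 K10]]] _] := sK1; have [_ [_ [cK2 K20]]] := kcK2.
have kF : compact F.
  by rewrite -(setIidr FK1); exact: compact_closedI.
have [N fN] := in_AA_bounded kcK2 kF fAA.
have [fA faff fc] := fAA.
set M := supnorm_AA F K2 f.
have fM k y : F k -> K2 y -> f k y <= M.
  move=> Fk Ky; apply: le_trans (ler_norm _) _.
  apply: le_trans (supnorm_ge (in_A_ubounded kcK2 (fA k Fk)) Ky) _.
  exact: supnorm_AA_ge fN k Fk.
have M0 : 0 <= M.
  have [F0|/set0P[k Fk]] := eqVneq F set0.
    by rewrite /M F0 supnorm_AA_set0.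
  by have [y Ky] := K20; exact: le_trans (f0 k Fk y Ky) (fM k y Fk Ky).
(* Equality with [f k] is asked on [K2] only, because elements of the function space are represented
   by functions on all of [E2]. *)
pose Phi k (v : E2 -> R) := [/\ in_A K2 v, forall y, K2 y -> 0 <= v y <= M &
  F k -> forall y, K2 y -> v y = f k y].
have cPhi : convex_relation K1 Phi.
  move=> k k' v w l Kk Kk' [Av vM vf] [Aw wM wf] /andP[l0 l1]; split.
  - exact: in_A_conv.
  - move=> y Ky; have /andP[? ?] := vM y Ky; have /andP[? ?] := wM y Ky.
    by apply/andP; split; nra.
  (* The face property concerns [0 < l < 1], where a combination in [F] forces both ends into [F];
     at the end values the combination is one of the two points itself. *)
  have [->|ln0] := eqVneq l 0.
    rewrite scale0r add0r subr0 scale1r => /wf wfk y Ky.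
    by rewrite wfk//; ring.
  have [->|ln1] := eqVneq l 1.
    rewrite subrr scale0r addr0 scale1r => /vf vfk y Ky.
    by rewrite vfk//; ring.
  have l01 : 0 < l < 1 by rewrite !lt_neqAle eq_sym ln0 l0 ln1 l1.
  move=> /(faceF _ _ _ Kk Kk' l01)[Fk Fk'] y Ky.
  by rewrite faff ?l0 ?l1// vf// wf.
have lPhi : lsc_relation K1 K2 Phi.
  move=> k v Kk [Av vM vf] e e0.
  (* Off [F], [v] remains admissible on the open complement. At a point of [F], nearby points of [F]
     use [f], and the others keep [v], which lies in the order interval. *)
  have [Fk|nFk] := pselect (F k); last first.
    exists (~` F).
      by apply: open_nbhs_nbhs; split=> //; exact: closed_openC.
    by move=> k' _ nFk'; exists v; [split|exact/uclose_refl/ltW].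
  have [U [Uk UP]] := fc k Fk e e0; exists U => // k' Kk' Uk'.
  have [Fk'|nFk'] := pselect (F k'); last first.
    by exists v; [split|exact/uclose_refl/ltW].
  exists (f k').
    by split=> //; [exact: fA|move=> y Ky; rewrite f0// fM].
  move=> y Ky; rewrite (vf Fk)//; apply: le_trans (ltW (UP k' Fk' Uk')).
  apply: (@supnorm_ge _ _ _ (fun x => f k' x - f k x)) Ky.
  apply: in_A_ubounded => //.
  have := in_A_scaleD (-1) (fA k Fk) (fA k' Fk').
  by under eq_fun do rewrite mulN1r addrC.
have [||g [ga gc] gP] := lsc_selection sK1 cPhi lPhi.
- move=> k Kk; have [Fk|nFk] := pselect (F k).
    exists (f k); split=> //; first exact: fA.
    by move=> y Ky; rewrite f0// fM.
  exists (fun=> 0); split=> //; first exact: in_A0.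
  by move=> y Ky; rewrite lexx.
- by move=> k v Kk [Av _ _]; exact: in_A_ubounded.
(* [g k] is known only up to arbitrary [e]; the bounds, the agreement on [F] and membership in the
   function space all survive uniform limits. *)
have gM k y : K1 k -> K2 y -> 0 <= g k y <= M.
  move=> Kk Ky; apply/andP; split; apply/ler_addgt0Pl => e e0.
    have [v [_ vM _] gv] := gP k Kk e e0; have /andP[v0 _] := vM y Ky.
    by have := gv y Ky; rewrite ler_norml => /andP[]; lra.
  have [v [_ vM _] gv] := gP k Kk e e0; have /andP[_ v1] := vM y Ky.
  by have := gv y Ky; rewrite ler_norml => /andP[]; lra.
have gf k y : F k -> K2 y -> g k y = f k y.
  move=> Fk Ky; apply/eqP; rewrite -subr_eq0 -normr_le0.
  apply/ler_addgt0Pl => e e0; rewrite addr0.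
  have [v [_ _ vf] gv] := gP k (FK1 k Fk) e e0.
  by rewrite -(vf Fk y Ky); exact: gv.
have gN k : K1 k -> forall y, K2 y -> `|g k y| <= M.
  by move=> Kk y Ky; have /andP[g0 g1] := gM k y Kk Ky; rewrite ger0_norm.
exists g; split=> //.
- split.
  + move=> k Kk; apply: in_A_limit => // e e0.
    by have [v [Av _ _] gv] := gP k Kk e e0; exists v => //; exact: uclose_sym.
  + by move=> k k' l Kk Kk' l01 x Kx; exact: ga.
  + move=> k Kk e e0; have [U Uk UP] := gc k Kk (e / 2) ltac:(lra).
    exists U; split=> // k' Kk' Uk'.
    apply: (@le_lt_trans _ _ (e / 2)); last lra.
    by apply: supnorm_le => // y Ky; exact: UP.
- by move=> k Kk x Kx; have /andP[] := gM k x Kk Kx.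
- by move=> k Fk x Kx; exact: gf.
apply: le_anti; apply/andP; split.
  apply: ge_sup; first by have [k Kk] := K10; exists (supnorm K2 (g k)), k.
  by move=> _ [k Kk <-]; apply: supnorm_le => //; exact: gN.
have gS := supnorm_AA_ge kcK2 gN.
(* For empty [F] the target is 0, below any norm of [g]. Otherwise each norm of [f k] is that of
   [g k]. *)
have [F0|/set0P[k0 Fk0]] := eqVneq F set0.
  rewrite /M F0 supnorm_AA_set0.
  have [k Kk] := K10; have [y Ky] := K20.
  apply: le_trans (gS k Kk); apply: le_trans (normr_ge0 (g k y)) _.
  by apply: supnorm_ge Ky; exists M; exact: gN.
apply: ge_sup; first by exists (supnorm K2 (f k0)), k0.
move=> _ [k Fk <-]; apply: le_trans (gS k (FK1 k Fk)).
by rewrite (supnorm_eq (fun y Ky => gf k y Fk Ky)).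
Qed.
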